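(* Let $d \ge 1$ be an integer, let $0<\theta<\theta_{d+1}$, and set $$\eta_d(\theta) := \arcsin\Big(\frac{\sin(\theta/2)}{\sin(\theta_d/2)}\Big) \in \Big(0,\frac{\pi}{2}\Big).$$ If $A \subseteq \mathbf{R}^{d+1}$ satisfies $\angle A \le \theta$, then $$|A| \le \frac{1}{f_d(\eta_d(\theta))}.$$
   Context: For an integer $k\ge 1$, $\theta_k := \arccos(-1/k)$. Angle bound: for a set $A\subseteq \mathbf{R}^{m}$, $\angle A$ denotes the smallest $\theta\in[0,\pi]$ such that no triple of points of $A$ determines an angle greater than $\theta$, i.e. such that $\frac{x-y}{|x-y|}\cdot\frac{z-y}{|z-y|}\ge \cos\theta$ for all $x,y,z\in A$ with $x\ne y$ and $z\neq y$. $|A|\in\{0,1,\dots,\infty\}$ denotes the cardinality of $A$ (so the conclusion includes that $A$ is finite). For $\eta\in(0,\pi/2)$, $f_d(\eta)$ is the fraction of the unit sphere $\mathbf{S}^d\subset\mathbf{R}^{d+1}$ (with respect to surface measure) consisting of those $x \in \mathbf{S}^d$ with $x\cdot z\le 0$ for every $z$ in the cone $C_{u,\eta}=\{z\in\mathbf{R}^{d+1} : u\cdot z\ge |u||z|\cos\eta\}$, where $0\ne u\in\mathbf{R}^{d+1}$ is arbitrary; equivalently, $$f_d(\eta)=\Big(\int_0^{\pi}\sin^{d-1}(t)\,dt\Big)^{-1}\int_0^{\frac{\pi}{2}-\eta}\sin^{d-1}(t)\,dt .$$ *)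

(* Defs.v *)
From HB Require Import structures.
From mathcomp Require Import all_boot all_order all_algebra finmap.
From mathcomp Require Import all_classical all_reals all_analysis.

Set Implicit Arguments.
Unset Strict Implicit.
Unset Printing Implicit Defensive.

Import Order.TTheory GRing.Theory Num.Theory.
Import numFieldNormedType.Exports.

Local Open Scope classical_set_scope.
Local Open Scope ring_scope.

Definition dot {R : realType} {n : nat} (x y : 'rV[R]_n) : R :=
  \sum_(i < n) x ord0 i * y ord0 i.

(* The Euclidean norm: the library norm of a row vector is the sup norm. *)
Definition enorm {R : realType} {n : nat} (x : 'rV[R]_n) : R :=
  Num.sqrt (dot x x).

Definition theta {R : realType} (k : nat) : R := acos (- (1 / k%:R)).

Definition no_angle_above {R : realType} {n : nat} (A : set 'rV[R]_n) (t : R) :=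
  forall x y z, A x -> A y -> A z -> x != y -> z != y ->
    cos t <= dot ((enorm (x - y))^-1 *: (x - y)) ((enorm (z - y))^-1 *: (z - y)).

(* The set below is closed and contains pi, so its infimum is its minimum. *)
Definition angle {R : realType} {n : nat} (A : set 'rV[R]_n) : R :=
  inf [set t | 0 <= t <= pi /\ no_angle_above A t].

(* Lebesgue measure on R^n, as the n-fold product of the measure on R: the
   integral of the measures of the sections, as in the library's product of two
   measures. As usual for such a formula, it is meant for Borel sets; those
   measured below are Borel. *)
Fixpoint lebesgueRn {R : realType} (n : nat) : set 'rV[R]_n -> \bar R :=
  match n return set 'rV[R]_n -> \bar R with
  | 0 => fun E => (\1_E (0 : 'rV[R]_0) : R)%:E
  | m.+1 => fun E => (\int[@lebesgue_measure R]_t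
      lebesgueRn [set v : 'rV[R]_m | E (row_mx (t%:M : 'rV[R]_1) v)])%E
  end.

Definition sphere {R : realType} (d : nat) : set 'rV[R]_d.+1 :=
  [set x | enorm x = 1].

(* Surface measure of a subset E of S^d, by integration in polar coordinates:
   the union of the radii ending in E has volume sigma(E) / (d + 1). *)
Definition surface_measure {R : realType} (d : nat) (E : set 'rV[R]_d.+1) :
    \bar R :=
  (d.+1%:R%:E * lebesgueRn
     [set (p.1 : R) *: p.2 | p in [set t : R | (0 < t <= 1)%R] `*` E])%E.

Definition cone {R : realType} {n : nat} (u : 'rV[R]_n) (eta : R) :
    set 'rV[R]_n :=
  [set z | enorm u * enorm z * cos eta <= dot u z].

Definition polar_cap {R : realType} (d : nat) (u : 'rV[R]_d.+1) (eta : R) :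
    set 'rV[R]_d.+1 :=
  [set x | sphere x /\ forall z, cone u eta z -> dot x z <= 0].

(* f_d(eta); it does not depend on the axis u != 0. *)
Definition cap_fraction {R : realType} (d : nat) (u : 'rV[R]_d.+1) (eta : R) :
    R :=
  fine (surface_measure (polar_cap u eta)) /
  fine (surface_measure (@sphere R d)).

Definition eta_d {R : realType} (d : nat) (t : R) : R :=
  asin (sin (t / 2) / sin (theta d / 2)).

(* Main.v *)
(**
At each point y of a finite subset of A, the unit vectors pointing to the other
points make pairwise angles at most t < theta_(d+1), so by the spherical Jung
inequality they lie in a circular cone of half-angle eta_d(t) about some axis
u_y. If w lies in the polar cones of the cones at y and at y', then both
w.(y' - y) <= 0 and w.(y - y') <= 0, so w lies in a hyperplane. Hence the polar
caps at the points of A overlap in null sets; since they are all isometric, the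
number of points times the measure of one cap is at most that of the sphere.

Jung's inequality: let p be the point of least norm in the convex hull of the
unit vectors v_i, with v_i.v_j >= c = cos t. Then p.v_i >= |p|^2 for all i, and
by Caratheodory p is a convex combination of at most d+1 of the v_i when p is
not 0 (at most d+2 when p = 0), which gives |p|^2 >= c + (1-c)/(d+1), the square
of cos(eta_d(t)) (respectively |p|^2 > 0, a contradiction).

The measures of isometric caps agree because Lebesgue measure on R^n, an
iterated integral, is scaled by |det g| under a linear map g; this follows by
induction on n from a block LU decomposition, the triangular factors acting by
translations on the fibres of a product.
*)
Require Import Defs.
From HB Require Import structures.
From mathcomp Require Import all_boot all_order all_algebra finmap.
From mathcomp Require Import all_classical all_reals all_analysis.
From mathcomp Require Import measurable_realfun ring lra.

Set Implicit Arguments.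
Unset Strict Implicit.
Unset Printing Implicit Defensive.

Import Order.TTheory GRing.Theory Num.Theory.
Import numFieldNormedType.Exports.

Local Open Scope classical_set_scope.
Local Open Scope ring_scope.

(** * Euclidean geometry and the spherical Jung inequality *)

Section dot_product.
Context {R : realType} {n : nat}.
Implicit Types x y z : 'rV[R]_n.

Lemma dotC x y : dot x y = dot y x.
Proof. by apply: eq_bigr => i _; rewrite mulrC. Qed.

Lemma dotDl x y z : dot (x + y) z = dot x z + dot y z.
Proof. by rewrite -big_split; apply: eq_bigr => i _; rewrite mxE mulrDl. Qed.

Lemma dotZl a x z : dot (a *: x) z = a * dot x z.
Proof. by rewrite mulr_sumr; apply: eq_bigr => i _; rewrite mxE mulrA. Qed.

Lemma dotNl x z : dot (- x) z = - dot x z.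
Proof. by rewrite -scaleN1r dotZl mulN1r. Qed.

Lemma dotDr x y z : dot z (x + y) = dot z x + dot z y.
Proof. by rewrite !(dotC z) dotDl. Qed.

Lemma dotZr a x z : dot z (a *: x) = a * dot z x.
Proof. by rewrite !(dotC z) dotZl. Qed.

Lemma dotNr x z : dot z (- x) = - dot z x.
Proof. by rewrite !(dotC z) dotNl. Qed.

Lemma dot0l x : dot 0 x = 0.
Proof. by rewrite -(scale0r 0) dotZl mul0r. Qed.

Definition dotE := (dotDl, dotDr, dotNl, dotNr, dotZl, dotZr).

Lemma dot_ge0 x : 0 <= dot x x.
Proof. by apply: sumr_ge0 => i _; rewrite -expr2 sqr_ge0. Qed.

Lemma dot_eq0 x : (dot x x == 0) = (x == 0).
Proof.
apply/eqP/eqP => [|->]; last exact: dot0l.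
move/psumr_eq0P => x0; apply/rowP => i; rewrite mxE.
by apply/eqP; rewrite -sqrf_eq0 expr2 x0// => j _; rewrite -expr2 sqr_ge0.
Qed.

Lemma enorm_ge0 x : 0 <= enorm x.
Proof. exact: sqrtr_ge0. Qed.

Lemma enorm_sqr x : enorm x ^+ 2 = dot x x.
Proof. by rewrite sqr_sqrtr// dot_ge0. Qed.

Lemma enorm_eq0 x : (enorm x == 0) = (x == 0).
Proof. by rewrite -sqrf_eq0 enorm_sqr dot_eq0. Qed.

Lemma enorm0 : enorm (0 : 'rV[R]_n) = 0.
Proof. by apply/eqP; rewrite enorm_eq0. Qed.

Lemma enorm_gt0 x : (0 < enorm x) = (x != 0).
Proof. by rewrite lt_def enorm_eq0 enorm_ge0 andbT. Qed.

Lemma enormZ a x : enorm (a *: x) = `|a| * enorm x.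
Proof.
by rewrite /enorm !dotE mulrA -expr2 sqrtrM ?sqr_ge0// sqrtr_sqr.
Qed.

Lemma cauchy_schwarz x y : `|dot x y| <= enorm x * enorm y.
Proof.
have [->|x0] := eqVneq x 0.
  by rewrite dot0l normr0 mulr_ge0 ?enorm_ge0.
rewrite -(@ler_pXn2r _ 2) ?nnegrE ?mulr_ge0 ?enorm_ge0//.
rewrite exprMn !enorm_sqr real_normK ?num_real//.
have xx : 0 < dot x x by rewrite lt_def dot_ge0 dot_eq0 x0.
have := dot_ge0 (dot x x *: y - dot x y *: x).
rewrite !dotE (dotC y x).
set a := dot x x in xx *; set b := dot x y; set c := dot y y => h.
suff : 0 <= a * (a * c - b ^+ 2) by rewrite pmulr_rge0// subr_ge0.
by apply: le_trans h _; rewrite le_eqVlt; apply/orP; left; apply/eqP; ring.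
Qed.

Lemma dot_le_enorm x y : dot x y <= enorm x * enorm y.
Proof. exact: le_trans (ler_norm _) (cauchy_schwarz _ _). Qed.

Lemma enorm_normalize x : x != 0 -> enorm ((enorm x)^-1 *: x) = 1.
Proof.
move=> x0; rewrite enormZ ger0_norm ?invr_ge0 ?enorm_ge0//.
by rewrite mulVf// enorm_eq0.
Qed.

End dot_product.

(** * Linear and conic combinations of the rows of a matrix *)

Lemma dot_suml {R : realType} n (I : finType) (F : I -> 'rV[R]_n) x :
  dot (\sum_i F i) x = \sum_i dot (F i) x.
Proof.
rewrite (big_morph (fun y => dot y x) (id1 := 0) (op1 := +%R))//.
  by move=> y z; rewrite dotDl.
exact: dot0l.
Qed.

Lemma dot_mull {R : realType} m n (l : 'rV[R]_m) (V : 'M[R]_(m, n)) x :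
  dot (l *m V) x = \sum_i l 0 i * dot (row i V) x.
Proof. by rewrite mulmx_sum_row dot_suml; apply: eq_bigr => i _; rewrite dotZl. Qed.

(** More than [k] rows in a space of dimension [k] are dependent: a kernel vector of the submatrix
    of the rows in [S] is extended by zero to all indices. *)
Lemma dependency_on {R : fieldType} m k (W : 'M[R]_(m, k)) (S : {pred 'I_m}) :
  (k < #|S|)%N ->
  exists mu : 'rV[R]_m,
    [/\ mu *m W = 0, mu != 0 & forall i, i \notin S -> mu 0 i = 0].
Proof.
move=> kS; pose f (j : 'I_#|S|) : 'I_m := enum_val j.
have : kermx (rowsub f W) != 0.
  by rewrite kermx_eq0 /row_free neq_ltn (leq_ltn_trans (rank_leq_col _))// orbC.
case/rowV0Pn => nu /sub_kermxP nuW nu0.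
have muE i : (nu *m rowsub f 1%:M) 0 i = \sum_j nu 0 j * (f j == i)%:R.
  by rewrite mxE; apply: eq_bigr => j _; rewrite !mxE.
exists (nu *m rowsub f 1%:M); split.
- by rewrite -mulmxA mul_rowsub_mx mul1mx.
- apply: contra_neq nu0 => mu0; apply/rowP => j; rewrite mxE.
  have := muE (f j); rewrite mu0 mxE (bigD1 j)//= eqxx mulr1 big1 ?addr0//.
  by move=> l lj; rewrite (inj_eq enum_val_inj) (negbTE lj) mulr0.
- move=> i iS; rewrite muE big1// => j _.
  by case: eqP => [fji|]; rewrite ?mulr0//; rewrite -fji enum_valP in iS.
Qed.

(** Induction on the size of the support: while it exceeds [k], subtracting a multiple of a
    dependency supported there kills a coefficient. The support never grows, which Jung's inequality
    uses to stay on the rows where [dot p (row i V) = dot p p]. *)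
Lemma conic_caratheodory {R : realFieldType} m k (W : 'M[R]_(m, k)) (l : 'rV[R]_m) :
  (forall i, 0 <= l 0 i) ->
  exists l' : 'rV[R]_m,
    [/\ forall i, 0 <= l' 0 i, l' *m W = l *m W,
        forall i, l 0 i = 0 -> l' 0 i = 0 & (#|[pred i | (l' 0 i != 0)%R]| <= k)%N].
Proof.
have [N] := ubnP #|[pred i | l 0 i != 0]|; elim: N l => // N IH l lN l0.
set S := [pred i | l 0 i != 0] in lN.
have [Sk|kS] := leqP #|S| k; first by exists l.
have [mu [muW mu0 muS]] : exists mu : 'rV[R]_m,
    [/\ mu *m W = 0, exists i, 0 < mu 0 i & forall i, i \notin S -> mu 0 i = 0].
  have [mu [muW mu0 muS]] := dependency_on W kS.
  have [i mui] : exists i, mu 0 i != 0.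
    apply/existsP; apply: contraNT mu0; rewrite negb_exists => /forallP mu0.
    by apply/eqP/rowP => i; rewrite mxE; apply/eqP/negPn/mu0.
  case: (ltgtP (mu 0 i) 0) mui => // [mui|mui] _.
    exists (- mu); split => [||j /muS]; rewrite ?mulNmx ?muW ?oppr0//.
      by exists i; rewrite mxE oppr_gt0.
    by rewrite mxE => ->; rewrite oppr0.
  by exists mu; split => //; exists i.
case: mu0 => i0 mui0.
(* The least ratio is the largest [s] for which [l - s *: mu] stays nonnegative, and the coefficient
   attaining it becomes zero. *)
case: (@arg_minP _ _ _ i0 (fun i => 0 < mu 0 i) (fun i => l 0 i / mu 0 i) mui0).
move=> j muj jmin; pose s := l 0 j / mu 0 j.
have s0 : 0 <= s by rewrite divr_ge0// ltW.
pose l1 := l - s *: mu.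
have l1E i : l1 0 i = l 0 i - s * mu 0 i by rewrite !mxE.
have l1S i : l 0 i = 0 -> l1 0 i = 0.
  by move=> li; rewrite l1E li muS ?inE ?li ?eqxx// mulr0 subr0.
have l1j : l1 0 j = 0 by rewrite l1E /s mulfVK ?subrr// gt_eqF.
have [||l' [l'0 l'W l'S l'k]] := IH l1.
- rewrite ltnS in lN; apply: leq_trans lN; apply: proper_card.
  apply/properP; split.
    by apply/fintype.subsetP => i; rewrite !inE; apply: contra_neq => /l1S.
  exists j; last by rewrite inE l1j eqxx.
  by apply: contraTT muj => /muS ->; rewrite ltxx.
- move=> i; rewrite l1E subr_ge0; have [mui|mui] := ltP 0 (mu 0 i).
    by rewrite -ler_pdivlMr//; apply: jmin.
  by apply: le_trans (l0 i); rewrite mulr_ge0_le0.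
exists l'; split => //; last by move=> i /l1S/l'S.
by rewrite l'W mulmxBl -scalemxAl muW scaler0 subr0.
Qed.

(** * The point of least norm of a convex hull, and Jung's inequality *)

Section continuity.
Context {R : realType} {T : topologicalType}.

Lemma continuous_sumr n (F : 'I_n -> T -> R) :
  (forall i, continuous (F i)) -> continuous (fun x => \sum_i F i x).
Proof.
move=> cF x; have -> : (fun x => \sum_i F i x) = \sum_i F i.
  by apply/funext => y; rewrite fct_sumE.
elim/big_ind: _ => [|f g cf cg|i _]; last exact: cF.
  exact: cst_continuous.
exact: continuousD.
Qed.

End continuity.

Lemma continuous_dot {R : realType} {T : topologicalType} n (f g : T -> 'rV[R]_n) :
  (forall i, continuous (fun x => f x 0 i)) ->
  (forall i, continuous (fun x => g x 0 i)) ->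
  continuous (fun x => dot (f x) (g x)).
Proof.
by move=> cf cg; apply: continuous_sumr => i x; apply: continuousM; [exact: cf|exact: cg].
Qed.

Definition simplex {R : realType} m : set 'rV[R]_m :=
  [set l | (forall i, 0 <= l 0 i) /\ \sum_i l 0 i = 1].

Lemma compact_simplex {R : realType} m : compact (@simplex R m).
Proof.
have cc i : continuous (fun l : 'rV[R]_m => l 0 i) by exact: coord_continuous.
apply: bounded_closed_compact.
  exists 1; split; first exact: num_real.
  move=> M M1 l [l0 l1]; rewrite /Num.norm/= mx_normrE; apply: bigmax_le => [|[i j] _].
    exact: le_trans ler01 (ltW M1).
  rewrite (ord1 i)/= ger0_norm// (le_trans _ (ltW M1))// -l1.
  by rewrite (bigD1 j)//= lerDl sumr_ge0.
have -> : @simplex R m =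
    (\bigcap_i [set l | 0 <= l 0 i]) `&` [set l | \sum_i l 0 i = 1].
  rewrite /simplex; apply/seteqP; split => [l [l0 l1]|l [l0 l1]]; split => // i.
    by move=> _; exact: l0.
  exact: l0 i I.
apply: closedI; first apply: closed_bigI => i _.
  exact: (closed_comp (fun x _ => cc i x) (@closed_ge _ 0)).
apply: (closed_comp (fun x _ => continuous_sumr cc (x:=x)) (@closed_eq _ 1)).
Qed.

(** The minimum exists by compactness of the simplex; the inequality is its first-order condition
    along the segment towards vertex [i]. *)
Lemma min_norm_hull {R : realType} m n (V : 'M[R]_(m.+1, n)) :
  exists l, simplex l /\
    forall i, dot (l *m V) (l *m V) <= dot (l *m V) (row i V).
Proof.
have cV j : continuous (fun l : 'rV[R]_m.+1 => (l *m V) 0 j).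
  have -> : (fun l : 'rV[R]_m.+1 => (l *m V) 0 j) = fun l => \sum_k l 0 k * V k j.
    by apply/funext => l; rewrite mxE.
  apply: continuous_sumr => k x; apply: continuousM; first exact: coord_continuous.
  exact: cst_continuous.
have s0 i : simplex (delta_mx 0 i : 'rV[R]_m.+1).
  split=> [j|]; first by rewrite mxE; rewrite ler0n.
  by rewrite (bigD1 i)//= mxE !eqxx big1 ?addr0// => j ji; rewrite mxE (negbTE ji) andbF.
have [|l /set_mem lS lmin] := EVT_min_rV _ (@compact_simplex R m.+1)
  (continuous_subspaceT (continuous_dot cV cV)).
  by exists (delta_mx 0 0); apply: s0.
exists l; split => // i; set p := l *m V in lmin *.
(* The increase of the squared norm after moving a fraction [s] of the way, divided by [s]. *)
have {}lmin s : 0 < s <= 1 -> 0 <= 2 * (dot p (row i V) - dot p p)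
    + s * dot (row i V - p) (row i V - p).
  move=> /andP[s0' s1].
  have /mem_set/lmin : simplex (l + s *: (delta_mx 0 i - l)).
    have [[l0 l1] [d0 d1]] := (lS, s0 i).
    have E (x : 'rV[R]_m.+1) j : (l + s *: (x - l)) 0 j = (1 - s) * l 0 j + s * x 0 j.
      by rewrite !mxE; ring.
    split=> [j|]; first by rewrite E addr_ge0 ?mulr_ge0 ?subr_ge0// ltW.
    rewrite (eq_bigr _ (fun j _ => E _ j)) big_split/= -!mulr_sumr l1 d1; ring.
  rewrite mulmxDl -scalemxAl mulmxBl -rowE -/p.
  rewrite -subr_ge0 => h; rewrite -(pmulr_rge0 _ s0').
  move: h; rewrite !dotE (dotC (row i V) p).
  by move/le_trans; apply; rewrite le_eqVlt; apply/orP; left; apply/eqP; ring.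
rewrite leNgt; apply/negP => plt.
set b := dot (row i V - p) (row i V - p) in lmin.
have b0 : 0 <= b by exact: dot_ge0.
have e0 : 0 < dot p p - dot p (row i V) by rewrite subr_gt0.
(* With [e] the supposed positive defect, this [s] satisfies [s * b <= e], so [- 2 * e + s * b] is
   negative. The [+ 1] keeps the denominator positive when [b = 0]. *)
have := lmin (Num.min 1 ((dot p p - dot p (row i V)) / (b + 1))).
rewrite ge_min lexx/= lt_min ltr01 (divr_gt0 e0) ?ltr_wpDl// => /(_ isT).
apply/negP; rewrite -ltNge => {lmin}.
set e := dot p p - dot p (row i V) in e0 *.
have : Num.min 1 (e / (b + 1)) * b <= e.
  apply: le_trans (_ : e / (b + 1) * b <= _).
    by rewrite ler_wpM2r// ge_min lexx orbT.
  rewrite -mulrA ler_piMr ?(ltW e0)// mulrC ler_pdivrMr ?mul1r ?ltr_wpDl//.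
  by rewrite lerDl.
rewrite (_ : dot p (row i V) - dot p p = - e); last by rewrite /e; ring.
by move=> h; lra.
Qed.

(** Expand the sum of [(l 0 i - e) ^+ 2] over the support, where [e] is the weight of the uniform
    distribution on [k.+1] points. *)
Lemma sum_sqr_ge {R : realFieldType} m (l : 'rV[R]_m) k :
  \sum_i l 0 i = 1 -> (#|[pred i | (l 0 i != 0)%R]| <= k.+1)%N ->
  k.+1%:R^-1 <= \sum_i l 0 i ^+ 2.
Proof.
set S := [pred i | _] => l1 Sk; set e : R := k.+1%:R^-1.
have e0 : 0 < e by rewrite invr_gt0.
have lS : \sum_(i in S) l 0 i = 1.
  rewrite -l1 [RHS](bigID (mem S))/= [X in _ + X]big1 ?addr0// => i.
  by rewrite !inE negbK => /eqP.
have : 0 <= \sum_(i in S) (l 0 i - e) ^+ 2 by apply: sumr_ge0 => i _; rewrite sqr_ge0.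
under eq_bigr do rewrite sqrrB.
rewrite big_split/= big_split/= sumrN sumr_const -mulrnAl.
rewrite sumrMnl -mulr_suml lS mul1r => h.
have : \sum_(i in S) l 0 i ^+ 2 <= \sum_i l 0 i ^+ 2.
  rewrite [leRHS](bigID (mem S))/= lerDl; apply: sumr_ge0 => i _; exact: sqr_ge0.
apply: le_trans.
have : e *+ #|S| * e <= e.
  rewrite ler_piMl ?(ltW e0)// -mulr_natr -mulrC.
  rewrite (@le_trans _ _ (k.+1%:R * e))// ?ler_wpM2r ?(ltW e0) ?ler_nat//.
  by rewrite /e divff// pnatr_eq0.
by rewrite mulr2n in h; lra.
Qed.

(** With [q] the sum of the squared weights, the diagonal terms contribute [q] and the others at
    least [c * (1 - q)]; the total [c + (1 - c) * q] increases with [q], which [sum_sqr_ge] bounds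
    below. *)
Lemma norm_hull_ge {R : realType} m n (V : 'M[R]_(m, n)) (l : 'rV[R]_m) c k :
  simplex l -> (#|[pred i | (l 0 i != 0)%R]| <= k.+1)%N -> c <= 1 ->
  (forall i, dot (row i V) (row i V) = 1) ->
  (forall i j, c <= dot (row i V) (row j V)) ->
  c + (1 - c) / k.+1%:R <= dot (l *m V) (l *m V).
Proof.
move=> [l0 l1] lk c1 V1 Vc; have lsq := sum_sqr_ge l1 lk.
apply: (@le_trans _ _ (c + (1 - c) * \sum_i l 0 i ^+ 2)).
  by rewrite lerD2l ler_wpM2l// subr_ge0.
have -> : c + (1 - c) * \sum_i l 0 i ^+ 2 =
    \sum_i (l 0 i * c + (1 - c) * l 0 i ^+ 2).
  by rewrite big_split/= -mulr_suml l1 mul1r -mulr_sumr.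
rewrite dot_mull.
apply: ler_sum => i _.
rewrite dotC dot_mull (bigD1 i)//= V1 mulr1 expr2 mulrDr.
rewrite (_ : l 0 i * c + (1 - c) * (l 0 i * l 0 i) =
  l 0 i * l 0 i + l 0 i * (c * (1 - l 0 i))); last by ring.
rewrite lerD2l ler_wpM2l// -l1 (bigD1 i)//= addrAC subrr add0r mulr_sumr.
by apply: ler_sum => j _; rewrite mulrC ler_wpM2l.
Qed.

Lemma spherical_jung {R : realType} m d (V : 'M[R]_(m.+1, d.+1)) c :
  c <= 1 -> 0 < 1 + d.+1%:R * c ->
  (forall i, dot (row i V) (row i V) = 1) ->
  (forall i j, c <= dot (row i V) (row j V)) ->
  exists p, (1 + d%:R * c) / d.+1%:R <= dot p p /\
    forall i, dot p p <= dot p (row i V).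
Proof.
move=> c1 cd V1 Vc; have [l [lS lmin]] := min_norm_hull V.
set p := l *m V in lmin; exists p; split => //.
have dn0 : d.+1%:R != 0 :> R by rewrite pnatr_eq0.
(* Complementary slackness: these differences are nonnegative and their average with weights [l] is
   zero. *)
have lp i : l 0 i != 0 -> dot p (row i V) = dot p p.
  move=> li; apply/eqP; rewrite -subr_eq0.
  have : \sum_i l 0 i * (dot p (row i V) - dot p p) = 0.
    under eq_bigr do rewrite mulrBr (dotC p).
    rewrite sumrB -dot_mull -mulr_suml lS.2 mul1r -/p.
    by rewrite subrr.
  move/psumr_eq0P => h; have /eqP : l 0 i * (dot p (row i V) - dot p p) = 0.
    by apply: h => // j _; rewrite mulr_ge0 ?subr_ge0 ?lmin//; apply: lS.1.
  by rewrite mulf_eq0 (negbTE li).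
have [p0|p0] := eqVneq p 0.
  (* The extra column of ones makes the conic combination convex. *)
  have [l' [l'0 l'W l'S l'k]] :=
    conic_caratheodory (row_mx V (const_mx 1 : 'cV_m.+1)) lS.1.
  move: l'W; rewrite !mul_mx_row => /eq_row_mx[l'V /rowP/(_ 0)].
  rewrite !mxE.
  under eq_bigr do rewrite mxE mulr1.
  under [in RHS]eq_bigr do rewrite mxE mulr1.
  rewrite lS.2 => l'1.
  rewrite addn1 in l'k.
  have := @norm_hull_ge R _ _ V l' c d.+1 (conj l'0 l'1) l'k c1 V1 Vc.
  rewrite l'V -/p p0 dot0l.
  rewrite (_ : c + _ = (1 + d.+1%:R * c) / d.+2%:R); last first.
    have : d.+2%:R != 0 :> R by rewrite pnatr_eq0.
    by rewrite -(natr1 d.+1) => ?; field.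
  by rewrite leNgt divr_gt0.
have [l' [l'0 l'V l'S l'k]] := conic_caratheodory V lS.1.
(* Convexity is automatic here: p.v_i = |p|^2 on the support of l. *)
have l'1 : \sum_i l' 0 i = 1.
  have pp : dot p p != 0 by rewrite dot_eq0.
  apply: (mulIf pp); rewrite mul1r.
  have {2}-> : dot p p = \sum_i l' 0 i * dot (row i V) p by rewrite -dot_mull l'V.
  rewrite mulr_suml.
  apply: eq_bigr => i _; have [li|li] := eqVneq (l 0 i) 0.
    by rewrite l'S// !mul0r.
  by rewrite -(lp i li) dotC.
have := @norm_hull_ge R _ _ V l' c d (conj l'0 l'1) l'k c1 V1 Vc.
rewrite l'V -/p; apply: le_trans.
rewrite le_eqVlt; apply/orP; left; apply/eqP; move: dn0.
by rewrite -(natr1 d) => ?; field.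
Qed.

(** * Lebesgue measure on R^n *)

Section borel.
Context {R : realType}.

Definition coords n (v : 'rV[R]_n) : n.-tuple (measurableTypeR R) :=
  [tuple v 0 i | i < n].

(** The Borel sigma-algebra of R^n, pulled back from the product sigma-algebra on tuples. *)
Definition borelRn n := g_sigma_algebra_preimageType (@coords n).
Arguments borelRn : clear implicits.

Lemma measurable_coord n i : measurable_fun setT (fun v : borelRn n => v 0 i).
Proof.
have -> : (fun v : borelRn n => v 0 i) = (@tnth _ _ ^~ i) \o @coords n.
  by apply/funext => v /=; rewrite tnth_mktuple.
apply: measurableT_comp; first exact: measurable_tnth.
by move=> _ B mB; exists B.
Qed.

Lemma measurable_fun_coordP d (T : measurableType d) n (f : T -> borelRn n) :
  (forall i, measurable_fun setT (fun x => f x 0 i)) -> measurable_fun setT f.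
Proof.
move=> mf.
have mcf : measurable_fun setT (@coords n \o f).
  apply/measurable_fun_tnthP => i.
  have -> : @tnth _ _ ^~ i \o (@coords n \o f) = fun x => f x 0 i; last exact: mf.
  by apply/funext => x /=; rewrite tnth_mktuple.
by move=> _ _ [B mB <-]; rewrite !setTI; have := mcf measurableT B mB; rewrite setTI.
Qed.

(** The same [row_mx] as in [lebesgueRn], so that sections of preimages under [consv] are the sets
    measured there. *)
Definition consv n (p : measurableTypeR R * borelRn n) : borelRn n.+1 :=
  row_mx (p.1%:M : 'rV[R]_1) p.2.

Definition unconsv n (v : borelRn n.+1) : measurableTypeR R * borelRn n :=
  ((v : 'rV_(1 + n)) 0 0, rsubmx (v : 'rV_(1 + n))).

Lemma consv0 n p : @consv n p 0 0 = p.1.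
Proof.
by rewrite /consv mxE; case: splitP => // j _; rewrite mxE ord1.
Qed.

Lemma consvS n p i : @consv n p 0 (lift 0 i) = p.2 0 i.
Proof.
rewrite /consv mxE; case: splitP => [j|j]; first by rewrite ord1.
by rewrite /= /bump/= add1n => -[/val_inj ->].
Qed.

Lemma consvK n : cancel (@consv n) (@unconsv n).
Proof.
move=> [t v]; rewrite /unconsv; congr pair; first exact: consv0.
by rewrite /consv row_mxKr.
Qed.

Lemma unconsvK n : cancel (@unconsv n) (@consv n).
Proof.
move=> v; apply/rowP => i; case: (unliftP 0 i) => [j|] ->.
  by rewrite consvS mxE; congr (v _ _); apply: val_inj.
by rewrite consv0.
Qed.

Lemma measurable_consv n : measurable_fun setT (@consv n).
Proof.
apply: measurable_fun_coordP => i; have [->|[j ->]] : i = 0 \/ exists j, i = lift 0 j.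
  by case: (unliftP 0 i) => [j|] ->; [right; exists j|left].
- under eq_fun do rewrite consv0; exact: measurable_fst.
- under eq_fun do rewrite consvS.
  exact: measurableT_comp (measurable_coord j) measurable_snd.
Qed.

Lemma measurable_unconsv n : measurable_fun setT (@unconsv n).
Proof.
apply: measurable_fun_pair; first exact: measurable_coord.
apply: measurable_fun_coordP => i; under eq_fun do rewrite mxE.
exact: measurable_coord.
Qed.

Section cons_measure.
Context n (mu : {sigma_finite_measure set (borelRn n) -> \bar R}).

(** The induction step for showing that [lebesgueRn] is a sigma-finite measure: product with the
    line, transported to row vectors. *)
Definition cons_measure : set (borelRn n.+1) -> \bar R :=
  pushforward (@lebesgue_measure R \x mu)%E (@consv n).

(* The instance making a pushforward a measure takes this fact from the context. *)
Let mconsv : measurable_fun setT (@consv n) := @measurable_consv n.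

Let cons_measure0 : cons_measure set0 = 0%E.
Proof. exact: measure0. Qed.

Let cons_measure_ge0 E : (0 <= cons_measure E)%E.
Proof. exact: measure_ge0. Qed.

Let cons_measure_sigma_additive : semi_sigma_additive cons_measure.
Proof. exact: measure_semi_sigma_additive. Qed.

HB.instance Definition _ := isMeasure.Build _ _ _ cons_measure
  cons_measure0 cons_measure_ge0 cons_measure_sigma_additive.

Let cons_measure_sigma_finite : sigma_finite setT cons_measure.
Proof.
have /sigma_finiteP[F [FT ndF Foo]] := sigma_finiteT (@lebesgue_measure R).
have /sigma_finiteP[G [GT ndG Goo]] := sigma_finiteT mu.
(* Both exhaustions are nondecreasing, so the rectangles with equal indices already cover the
   product. *)
exists (fun k => @unconsv n @^-1` (F k `*` G k)).
  rewrite -preimage_bigcup -[LHS](preimage_setT (@unconsv n)); congr (_ @^-1` _).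
  apply/seteqP; split => // -[x y] _.
  have [i _ Fx] : (\bigcup_k F k) x by rewrite -FT.
  have [j _ Gy] : (\bigcup_k G k) y by rewrite -GT.
  exists (maxn i j) => //; split => /=.
    by apply: (subsetPset _ _ (ndF _ _ (leq_maxl i j))).
  by apply: (subsetPset _ _ (ndG _ _ (leq_maxr i j))).
move=> k; have [[mF Flt] [mG Glt]] := (Foo k, Goo k); split.
  rewrite -[X in measurable X]setTI; apply: measurable_unconsv => //.
  exact: measurableX.
rewrite /cons_measure /pushforward -comp_preimage.
rewrite (_ : _ \o _ = id); last by apply/funext => p; exact: consvK.
by rewrite [X in (X < _)%E]product_measure1E// lte_mul_pinfty// ge0_fin_numE.
Qed.

HB.instance Definition _ :=
  Measure_isSigmaFinite.Build _ _ _ cons_measure cons_measure_sigma_finite.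

End cons_measure.

Lemma cons_measureE n (mu : {sigma_finite_measure set (borelRn n) -> \bar R}) :
  mu = @lebesgueRn R n :> (set (borelRn n) -> \bar R) ->
  cons_measure mu = @lebesgueRn R n.+1 :> (set (borelRn n.+1) -> \bar R).
Proof.
rewrite /cons_measure => ->; apply/funext => E; apply: eq_integral => t _ /=.
by congr lebesgueRn; apply/seteqP; split => v /=; rewrite /xsection/= inE.
Qed.

Lemma lebesgueRn_sigma_finite_measure n :
  exists mu : {sigma_finite_measure set (borelRn n) -> \bar R},
  mu = @lebesgueRn R n :> (set (borelRn n) -> \bar R).
Proof.
elim: n => [|n [mu muE]]; last by exists (cons_measure mu); exact: cons_measureE.
(* In dimension 0 the measure is the point mass at the only vector. *)
by exists (\d_(0 : borelRn 0)).
Qed.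

(** A name for [lebesgueRn] on [borelRn] that carries the measure structure. *)
Definition leb n : set (borelRn n) -> \bar R := @lebesgueRn R n.
Arguments leb : clear implicits.

Let leb0 n : leb n set0 = 0%E.
Proof.
have [mu muE] := lebesgueRn_sigma_finite_measure n.
by rewrite /leb -muE measure0.
Qed.

Let leb_ge0 n E : (0 <= leb n E)%E.
Proof.
have [mu muE] := lebesgueRn_sigma_finite_measure n.
by rewrite /leb -muE measure_ge0.
Qed.

Let leb_sigma_additive n : semi_sigma_additive (leb n).
Proof.
have [mu muE] := lebesgueRn_sigma_finite_measure n.
rewrite /leb -muE; exact: measure_semi_sigma_additive.
Qed.

Let leb_sigma_finite n : sigma_finite setT (leb n).
Proof.
have [mu muE] := lebesgueRn_sigma_finite_measure n.
rewrite /leb -muE; exact: sigma_finiteT.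
Qed.

HB.instance Definition _ n := isMeasure.Build _ _ _ (leb n)
  (leb0 n) (@leb_ge0 n) (@leb_sigma_additive n).

HB.instance Definition _ n :=
  Measure_isSigmaFinite.Build _ _ _ (leb n) (@leb_sigma_finite n).

Lemma lebS n E : leb n.+1 E = (@lebesgue_measure R \x leb n)%E (@consv n @^-1` E).
Proof. by rewrite /leb -(cons_measureE (mu := leb n)). Qed.

(** Tonelli: both iterated integrals agree on rectangles, hence everywhere. Integrating over the
    first coordinate first is the order suited to a shear in that coordinate. *)
Lemma lebS_sym n E : measurable E ->
  leb n.+1 E = (@lebesgue_measure R \x^ leb n)%E (@consv n @^-1` E).
Proof.
move=> mE; rewrite lebS.
apply: (product_measure_unique _ (m' := (@lebesgue_measure R \x^ leb n)%E)).
  by move=> A B mA mB; exact: product_measure2E.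
by rewrite -[X in measurable X]setTI; apply: measurable_consv.
Qed.

End borel.
Arguments borelRn : clear implicits.
Arguments leb : clear implicits.

(** * Affine substitutions on the line *)

Section linear_change_of_variables.
Context {R : realType}.
Local Notation mu := (@lebesgue_measure R).

Lemma measurable_affine (a b : R) :
  measurable_fun setT (fun t : measurableTypeR R => a * t + b : measurableTypeR R).
Proof. by apply: measurable_funD => //; exact: measurable_funM. Qed.

(** By uniqueness of Lebesgue measure it suffices to compare half-open intervals; the sign of [a]
    decides which end of the preimage is closed. *)
Lemma lebesgue_measure_affine (a b : R) (A : set (measurableTypeR R)) :
  a != 0 -> measurable A ->
  (`|a|%:E * mu ((fun t => (a * t + b)%R) @^-1` A))%E = mu A.
Proof.
move=> a0 mA; have ma := measurable_affine a b.
pose nu := mscale (NngNum (normr_ge0 a))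
  (pushforward mu (fun t : measurableTypeR R => a * t + b : measurableTypeR R)).
change (nu ma A = mu A).
apply/esym/(@lebesgue_measure_unique R (nu ma)) => // _ [[x y]] _ <-.
rewrite lebesgue_measure_itv/=.
rewrite -[RHS]/(`|a|%:E * mu ((fun t => (a * t + b)%R) @^-1` `]x, y]))%E.
case: (ltgtP a 0) a0 => // a0 _.
- rewrite (_ : _ @^-1` _ = `[(y - b) / a, (x - b) / a[%classic); last first.
    apply/seteqP; split => t; rewrite /= !in_itv/=.
      by rewrite ler_ndivrMr// ltr_ndivlMr// lerBrDr ltrBlDr !(mulrC t) andbC.
    by rewrite ler_ndivrMr// ltr_ndivlMr// lerBrDr ltrBlDr !(mulrC t) andbC.
  rewrite lebesgue_measure_itv/= !lte_fin ltr_nM2r ?invr_lt0// ltrD2r.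
  case: ifP => _; last by rewrite mule0.
  rewrite -!EFinB -EFinM ltr0_norm//; congr EFin.
  by field; rewrite lt_eqF.
- rewrite (_ : _ @^-1` _ = `](x - b) / a, (y - b) / a]%classic); last first.
    apply/seteqP; split => t; rewrite /= !in_itv/=.
      by rewrite ler_pdivlMr// ltr_pdivrMr// lerBrDr ltrBlDr !(mulrC t).
    by rewrite ler_pdivlMr// ltr_pdivrMr// lerBrDr ltrBlDr !(mulrC t).
  rewrite lebesgue_measure_itv/= !lte_fin ltr_pM2r ?invr_gt0// ltrD2r.
  case: ifP => _; last by rewrite mule0.
  rewrite -!EFinB -EFinM gtr0_norm//; congr EFin.
  by field; rewrite gt_eqF.
Qed.

Lemma integral_affine (a b : R) (f : R -> \bar R) : a != 0 ->
  measurable_fun setT (f : measurableTypeR R -> _) -> (forall t, (0 <= f t)%E) ->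
  (`|a|%:E * \int[mu]_t f (a * t + b)%R)%E = (\int[mu]_t f t)%E.
Proof.
move=> a0 mf f0; have ma := measurable_affine a b.
pose phi (t : measurableTypeR R) : measurableTypeR R := a * t + b.
pose nu := mscale (NngNum (normr_ge0 a)) (pushforward mu phi).
transitivity (\int[nu ma]_t f t)%E.
  rewrite ge0_integral_mscale//=; congr (_ * _)%E.
  by rewrite ge0_integral_pushforward//.
by apply: eq_measure_integral => A mA _; exact: lebesgue_measure_affine.
Qed.
End linear_change_of_variables.

(** * Volume scaling by invertible linear maps *)

Section linear_maps.
Context {R : realType}.
Local Notation mu := (@lebesgue_measure R).

Lemma measurable_preimage d1 d2 (T1 : measurableType d1) (T2 : measurableType d2)
    (f : T1 -> T2) (B : set T2) :
  measurable_fun setT f -> measurable B -> measurable (f @^-1` B).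
Proof. by move=> mf mB; rewrite -[X in measurable X]setTI; exact: mf. Qed.

(* [phi] multiplies volumes by [c]; stated with preimages, so [phi] need not be
   known to map measurable sets to measurable sets. *)
Definition scales_volume n (phi : borelRn R n -> borelRn R n) (c : R) :=
  measurable_fun setT phi /\
  forall E, measurable E -> (c%:E * leb R n (phi @^-1` E) = leb R n E)%E.

Lemma scales_volume_comp n (phi psi : borelRn R n -> borelRn R n) b c :
  scales_volume phi b -> scales_volume psi c -> scales_volume (phi \o psi) (b * c).
Proof.
move=> [mphi phib] [mpsi psic]; split; first exact: measurableT_comp.
move=> E mE; rewrite comp_preimage EFinM -muleA psic ?phib//.
exact: measurable_preimage.
Qed.

Definition slice n (t : R) (E : set (borelRn R n.+1)) : set (borelRn R n) :=
  [set v | E (consv (t, v))].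

Lemma lebS_slice n E : (leb R n.+1 E = \int[mu]_t leb R n (slice t E))%E.
Proof.
rewrite lebS; apply: eq_integral => t _ /=.
by congr leb; apply/seteqP; split => v /=; rewrite /xsection/= inE.
Qed.

Lemma measurable_consv_pre n (E : set (borelRn R n.+1)) :
  measurable E -> measurable (@consv R n @^-1` E).
Proof. by apply: measurable_preimage; exact: measurable_consv. Qed.

Lemma sliceE n (E : set (borelRn R n.+1)) t :
  slice t E = xsection (@consv R n @^-1` E) t.
Proof. by apply/seteqP; split => v /=; rewrite /xsection/= inE. Qed.

Lemma measurable_slice n t (E : set (borelRn R n.+1)) :
  measurable E -> measurable (slice t E).
Proof.
move=> mE; rewrite sliceE; apply: measurable_xsection.
exact: measurable_consv_pre.
Qed.

Lemma measurable_leb_slice n (E : set (borelRn R n.+1)) : measurable E ->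
  measurable_fun setT (fun t : measurableTypeR R => leb R n (slice t E)).
Proof.
move=> mE; have := measurable_fun_xsection (leb R n) (measurable_consv_pre mE).
by apply: eq_measurable_fun => t _; rewrite sliceE.
Qed.

(** Fubini: the fibre over [t] goes to the fibre over [a * t + b] with factor [c], and the
    substitution in the base contributes [|a|]. *)
Lemma scales_volume_fibered n (a b c : R) (phi : R -> borelRn R n -> borelRn R n)
    (Phi : borelRn R n.+1 -> borelRn R n.+1) :
  a != 0 -> 0 <= c -> measurable_fun setT Phi ->
  (forall t, scales_volume (phi t) c) ->
  (forall t v, Phi (consv (t, v)) = consv (a * t + b, phi t v)) ->
  scales_volume Phi (`|a| * c).
Proof.
move=> a0 c0 mPhi phic PhiE; split => // E mE.
rewrite !lebS_slice EFinM -muleA -ge0_integralZl//; last first.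
  by apply: measurable_leb_slice; exact: measurable_preimage.
rewrite -(integral_affine b a0 (measurable_leb_slice mE)) => [|t]; last first.
  exact: measure_ge0.
congr (_ * _)%E; apply: eq_integral => t _.
rewrite -[RHS](phic t).2; last exact: measurable_slice.
by congr (_ * leb _ _ _)%E; apply/seteqP; split => v; rewrite /slice/= PhiE.
Qed.

(** In the other order of integration, each line with [v] fixed is merely translated by [l v]. *)
Lemma scales_volume_shear n (l : borelRn R n -> R)
    (Phi : borelRn R n.+1 -> borelRn R n.+1) :
  measurable_fun setT Phi ->
  (forall t v, Phi (consv (t, v)) = consv (t + l v, v)) ->
  scales_volume Phi 1.
Proof.
move=> mPhi PhiE; split => // E mE; rewrite mul1e !lebS_sym//; last first.
  exact: measurable_preimage.
apply: eq_integral => v _ /=.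
have mEv : measurable (ysection (@consv R n @^-1` E) v).
  by apply: measurable_ysection; exact: measurable_consv_pre.
rewrite -(lebesgue_measure_affine (l v) (oner_neq0 R) mEv) normr1 mul1e.
congr (mu _); apply/seteqP; split => t; rewrite /ysection/= !inE/= PhiE mul1r//.
Qed.

Lemma scales_volume_id n : scales_volume (@id (borelRn R n)) 1.
Proof. by split => // E mE; rewrite mul1e preimage_id. Qed.

Lemma scales_volume_translation n (w : borelRn R n) :
  scales_volume (fun v => v + w : borelRn R n) 1.
Proof.
have mD k (u : borelRn R k) :
    measurable_fun setT (fun v : borelRn R k => v + u : borelRn R k).
  apply: measurable_fun_coordP => i; under eq_fun do rewrite mxE.
  by apply: measurable_funD => //; exact: measurable_coord.
elim: n w => [|n IH] w.
  rewrite (_ : (fun v => _) = id); first exact: scales_volume_id.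
  by apply/funext => v; apply/rowP => -[].
rewrite -(mul1r 1) -{1}(normr1 R).
apply: (@scales_volume_fibered _ _ (w 0 0) _ (fun _ v => v + (unconsv w).2)) => // t v.
rewrite -{1}(unconsvK w); apply/rowP => i; rewrite mxE mul1r.
by case: (unliftP 0 i) => [j|] ->; rewrite ?consvS ?consv0//= [RHS]mxE.
Qed.

Lemma measurable_mulmxr n (g : 'M[R]_n) :
  measurable_fun setT (fun v : borelRn R n => v *m g : borelRn R n).
Proof.
apply: measurable_fun_coordP => i; under eq_fun do rewrite mxE.
by apply: measurable_sum => j; apply: measurable_funM => //; exact: measurable_coord.
Qed.

Lemma scales_volume_mulmxr_comp n (g h : 'M[R]_n) b c :
  scales_volume (fun v : borelRn R n => v *m g : borelRn R n) b ->
  scales_volume (fun v : borelRn R n => v *m h : borelRn R n) c ->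
  scales_volume (fun v : borelRn R n => v *m (h *m g) : borelRn R n) (b * c).
Proof.
move=> gb hc; rewrite (_ : (fun v => _) =
    (fun v : borelRn R n => v *m g : borelRn R n) \o (fun v => v *m h)).
  exact: scales_volume_comp.
by apply/funext => v /=; rewrite mulmxA.
Qed.

Lemma mul_consv_block n (t : R) (v : 'rV[R]_n) (a : 'M[R]_1) b c (D : 'M[R]_n) :
  (consv (t, v) : 'rV[R]_(1 + n)) *m block_mx a b c D =
  consv (t * a 0 0 + (v *m c) 0 0, t *: b + v *m D).
Proof.
rewrite /consv/= mul_row_block !mul_scalar_mx; congr row_mx.
by apply/rowP => i; rewrite !ord1 !mxE eqxx mulr1n.
Qed.

(** A matrix with nonzero corner entry factors as lower unitriangular, block diagonal and upper
    unitriangular: the first acts as a shear, the other two are fibred over the first coordinate. *)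
Lemma scales_volume_mulmxr n (g : 'M[R]_n) : g \in unitmx ->
  scales_volume (fun v : borelRn R n => v *m g : borelRn R n) `|\det g|.
Proof.
elim: n g => [|n IH] g gu.
  rewrite det_mx00 normr1.
  rewrite (_ : (fun v => _) = id); first exact: scales_volume_id.
  by apply/funext => v; apply/rowP => -[].
have low (c : 'cV[R]_n) : scales_volume (fun v : borelRn R n.+1 =>
    v *m (block_mx 1%:M 0 c 1%:M : 'M[R]_(1 + n)) : borelRn R n.+1) 1.
  apply: (@scales_volume_shear _ (fun v => (v *m c) 0 0)); first exact: measurable_mulmxr.
  by move=> t v; rewrite mul_consv_block scaler0 add0r mulmx1 mxE eqxx mulr1n mulr1.
have upp (b : 'rV[R]_n) : scales_volume (fun v : borelRn R n.+1 =>
    v *m (block_mx 1%:M b 0 1%:M : 'M[R]_(1 + n)) : borelRn R n.+1) 1.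
  have E : (1 : R) = `|1| * 1 by rewrite normr1 mulr1.
  rewrite [X in scales_volume _ X]E.
  apply: (@scales_volume_fibered _ _ 0 _ (fun t v => v + t *: b)) => //.
  - exact: measurable_mulmxr.
  - by move=> t; exact: scales_volume_translation.
  - move=> t v; rewrite mul_consv_block !mulmx0 mulmx1 !mxE eqxx mulr1n.
    by rewrite mulr1 mul1r [v + _]addrC.
have diag (a : R) (D : 'M[R]_n) : a != 0 -> D \in unitmx ->
    scales_volume (fun v : borelRn R n.+1 =>
    v *m (block_mx a%:M 0 0 D : 'M[R]_(1 + n)) : borelRn R n.+1) (`|a| * `|\det D|).
  move=> a0 Du.
  apply: (@scales_volume_fibered _ _ 0 _ (fun t v => v *m D)) => //.
  - exact: measurable_mulmxr.
  - by move=> t; exact: IH.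
  - by move=> t v; rewrite mul_consv_block mulmx0 scaler0 add0r !mxE eqxx mulr1n mulrC.
have main (h : 'M[R]_(1 + n)) : h \in unitmx -> h 0 0 != 0 ->
    scales_volume (fun v : borelRn R n.+1 => v *m h : borelRn R n.+1) `|\det h|.
  move=> hu h0; set a := h 0 0 in h0.
  (* [D] is the Schur complement of the pivot [a]. *)
  pose b := ursubmx h; pose c := dlsubmx h; pose D := drsubmx h - a^-1 *: (c *m b).
  have hE : h = block_mx 1%:M 0 (a^-1 *: c) 1%:M *m
      (block_mx a%:M 0 0 D *m block_mx 1%:M (a^-1 *: b) 0 1%:M).
    rewrite !mulmx_block !(mul0mx, mulmx0, mul1mx, mulmx1, addr0, add0r).
    rewrite -!scalemxAl -!scalemxAr !mul_scalar_mx !mul_mx_scalar !scalerA.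
    rewrite mulVf// !scale1r -scalemxAr scalerA divfK// addrC subrK.
    rewrite -[LHS]submxK; congr block_mx.
    by apply/rowP => i; rewrite !ord1 !mxE/= mulr1n; congr (h _ _); exact: val_inj.
  have dh : \det h = a * \det D.
    rewrite hE !det_mulmx det_lblock !det_ublock !det1 det_scalar1.
    by rewrite !mul1r !mulr1.
  have Du : D \in unitmx.
    by move: hu; rewrite !unitmxE dh !unitfE mulf_eq0 negb_or => /andP[].
  rewrite dh normrM -[X in scales_volume _ X]mulr1 {1}hE.
  apply: scales_volume_mulmxr_comp (low _).
  rewrite -[X in scales_volume _ X]mul1r.
  exact: scales_volume_mulmxr_comp (upp _) (diag _ _ h0 Du).
move: g gu; rewrite -[n.+1]/(1 + n)%N => g gu.
have [g0|g0] := eqVneq (g 0 0) 0; last exact: (main g gu g0).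
(* Otherwise row 0 vanishes and the determinant, expanded along it, is zero. *)
have [j gj] : exists j : 'I_n, g 0 (lift 0 j) != 0.
  apply/existsP; apply: contraTT gu; rewrite negb_exists => /forallP gz.
  rewrite unitmxE unitfE negbK; apply/eqP.
  rewrite (expand_det_row _ 0) big1// => k _.
  case: (unliftP 0 k) => [j|] ->; last by rewrite g0 mul0r.
  by have /negPn/eqP -> := gz j; rewrite mul0r.
(* Adding another column to the first one makes the pivot nonzero. *)
pose e : 'cV[R]_n := delta_mx j 0.
pose S (x : R) : 'M[R]_(1 + n) := block_mx 1%:M 0 (x *: e) 1%:M.
have SS : S 1 *m S (-1) = 1%:M.
  rewrite mulmx_block !(mul0mx, mulmx0, mul1mx, mulmx1, addr0, add0r).
  by rewrite -scalerDl subrr scale0r -scalar_mx_block.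
have gS : g = (g *m S 1) *m S (-1) by rewrite -mulmxA SS mulmx1.
have dS : \det (g *m S 1) = \det g.
  by rewrite det_mulmx /S det_lblock !det1 !mulr1.
rewrite -dS -[X in scales_volume _ X]mul1r {1}gS.
apply: scales_volume_mulmxr_comp; first exact: low.
apply: main; first by rewrite unitmxE dS -unitmxE.
(* The pivot depends on row 0 of [g] alone, and becomes the nonzero entry [g 0 (lift 0 j)]. *)
have -> : (g *m S 1) 0 0 = (row 0 g *m S 1) 0 0 by rewrite -row_mul [RHS]mxE.
rewrite -[row 0 g]unconsvK mul_consv_block consv0/= mxE g0 mul0r add0r scale1r.
by rewrite -colE !mxE (_ : rshift 1 j = lift 0 j)//; exact: val_inj.
Qed.

End linear_maps.

(** * Boxes, used as outer and inner bounds for volumes *)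

Section boxes.
Context {R : realType}.

Definition box n (c : 'rV[R]_n) (r : R) : set (borelRn R n) :=
  [set v | forall i, ball (c 0 i) r (v 0 i)].

Lemma measurable_box n (c : 'rV[R]_n) r : measurable (box c r).
Proof.
have -> : box c r = \bigcap_i ((fun v : borelRn R n => v 0 i) @^-1`
    (ball (c 0 i) r : set (measurableTypeR R))).
  by apply/seteqP; split => v h i => [_|]; [exact: h|exact: h i I].
apply: fin_bigcap_measurable => // i _.
apply: measurable_preimage; [exact: measurable_coord|exact: measurable_ball].
Qed.

(** The slice at [t] is a box of one dimension less if [t] lies in the first interval, and is empty
    otherwise. *)
Lemma leb_box n (c : 'rV[R]_n) r : 0 <= r -> leb R n (box c r) = ((2 * r) ^+ n)%:E.
Proof.
move=> r0; elim: n c => [|n IH] c.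
  rewrite expr0 /leb/= indicE mem_set// => -[]//.
rewrite lebS_slice.
under eq_integral => t _.
  rewrite (_ : leb R n _ = ((2 * r) ^+ n)%:E * (\1_(ball (c 0 0) r) t)%:E)%E; first over.
  rewrite indicE; case: (boolP (t \in _)) => [/set_mem|/negP] tc.
    rewrite mule1 -(IH (unconsv c).2); congr leb.
    apply/seteqP; split => v h i.
      by have := h (lift 0 i); rewrite consvS/= -{1}(unconsvK c) consvS.
    case: (unliftP 0 i) => [j|] ->; last by rewrite consv0.
    by rewrite consvS -{1}(unconsvK c) consvS; exact: h.
  rewrite mule0 -(measure0 (leb R n)); congr leb; apply/seteqP; split => v //= /(_ 0).
  by rewrite consv0/= => h; apply: tc; exact: mem_set.
rewrite ge0_integralZl//; last 2 first.
- by apply/measurable_EFinP; apply: measurable_indic; exact: measurable_ball.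
- by rewrite lee_fin exprn_ge0// mulr_ge0.
rewrite integral_indic //=; last exact: measurable_ball.
rewrite setIT.
by rewrite lebesgue_measure_ball// -EFinM exprSr mulr_natl.
Qed.

End boxes.

(** * Measure of polar caps *)

Section cones.
Context {R : realType} {n : nat}.
Implicit Types u x z : 'rV[R]_n.

(** The vectors on the left are the components orthogonal to [u], multiplied by [dot u u] to avoid
    division. *)
Lemma dot_orthogonal_part u x z :
  dot (dot u u *: x - dot u x *: u) (dot u u *: z - dot u z *: u) =
  dot u u * (dot u u * dot x z - dot u x * dot u z).
Proof. by rewrite !dotE (dotC x u); ring. Qed.

(** With [s] and [c] the sine and cosine of the half-angle, the polar of a circular cone is the
    circular cone about [- u] of complementary half-angle. One direction tests a boundary generator;
    the other applies Cauchy-Schwarz to the components orthogonal to [u]. *)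
Lemma polar_coneP u x (s c : R) : u != 0 -> 0 <= s -> 0 <= c ->
  s ^+ 2 + c ^+ 2 = 1 ->
  (forall z, enorm u * enorm z * c <= dot u z -> dot x z <= 0) <->
  dot u x <= - (s * (enorm u * enorm x)).
Proof.
move=> u0 s0 c0 sc.
have U0 : 0 < enorm u by rewrite enorm_gt0.
have UE : dot u u = enorm u ^+ 2 by rewrite enorm_sqr.
have [s1 c1] : s <= 1 /\ c <= 1.
  by split; rewrite -(@expr_le1 _ 2)// -sc ?lerDl ?lerDr sqr_ge0.
have xx y : dot y y = enorm y ^+ 2 by rewrite enorm_sqr.
split=> [h|ux z uz].
- have [x' x'D] : {x' | x' = dot u u *: x - dot u x *: u} by eexists.
  (* The axis [u] itself lies in the cone. *)
  have ux : dot u x <= 0.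
    rewrite dotC; apply: h; rewrite UE -expr2.
    by rewrite ler_piMr// sqr_ge0.
  have x'E : enorm x' ^+ 2 = enorm u ^+ 2 * (enorm u ^+ 2 * enorm x ^+ 2 - dot u x ^+ 2).
    by rewrite enorm_sqr x'D dot_orthogonal_part UE -expr2 xx.
  have ux' : dot u x' = 0 by rewrite x'D !dotE; ring.
  have xx' : dot x x' = enorm u ^+ 2 * enorm x ^+ 2 - dot u x ^+ 2.
    by rewrite x'D !dotE (dotC x u) UE xx expr2.
  have key : s * enorm x' <= - (c * dot u x * enorm u).
    have [x'0|x'0] := eqVneq x' 0.
      rewrite x'0 enorm0.
      by rewrite mulr0 -mulNr -mulrN mulr_ge0 ?mulr_ge0 ?oppr_ge0// ltW.
    have x'p : 0 < enorm x' by rewrite enorm_gt0.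
    (* A generator of the cone in the plane of u and x, on the side of x. *)
    pose z := (c * enorm x') *: u + (s * enorm u) *: x'.
    have zn : enorm z = enorm u * enorm x'.
      apply/eqP; rewrite -(@eqrXn2 _ 2)// ?mulr_ge0 ?enorm_ge0// enorm_sqr /z.
      rewrite !dotE (dotC x' u) ux' !xx; apply/eqP.
      by rewrite -[RHS]mul1r -sc; ring.
    have : dot x z <= 0.
      by apply: h; rewrite zn /z !dotE ux' UE le_eqVlt; apply/orP; left; apply/eqP; ring.
    rewrite /z !dotE xx' (dotC x u) => hz.
    have : enorm u * (c * enorm x' * dot u x +
        s * enorm u * (enorm u ^+ 2 * enorm x ^+ 2 - dot u x ^+ 2)) <= 0.
      by rewrite pmulr_rle0.
    rewrite (_ : _ * _ = enorm x' * (s * enorm x' + c * dot u x * enorm u)).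
      by rewrite pmulr_rle0// => hh; rewrite -subr_le0 opprK.
    by rewrite mulrDr [in RHS]mulrDr [enorm x' * (s * _)]mulrCA -expr2 x'E; ring.
  (* Squaring [key] and replacing [c ^+ 2] by [1 - s ^+ 2] cancels the terms in
     [s ^+ 2 * dot u x ^+ 2]. *)
  rewrite lerNr -(@ler_pXn2r _ 2) ?nnegrE ?oppr_ge0 ?mulr_ge0 ?enorm_ge0//.
  rewrite -(@ler_pXn2r _ 2) ?nnegrE ?mulr_ge0 ?enorm_ge0// in key; last first.
    by rewrite -mulNr mulr_ge0 ?(ltW U0)// -mulrN mulr_ge0// oppr_ge0.
  rewrite exprMn x'E in key.
  rewrite -subr_ge0 -(pmulr_rge0 _ (exprn_gt0 2 U0)).
  have e2 : c ^+ 2 = 1 - s ^+ 2 by rewrite -sc addrC addKr.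
  rewrite sqrrN 2!exprMn e2 -subr_ge0 in key.
  by apply: le_trans key _; rewrite le_eqVlt; apply/orP; left; apply/eqP; ring.
- set x' := dot u u *: x - dot u x *: u; set z' := dot u u *: z - dot u z *: u.
  have e2 : c ^+ 2 = 1 - s ^+ 2 by rewrite -sc addrC addKr.
  have X0 := enorm_ge0 x; have Z0 := enorm_ge0 z.
  have nx : enorm x' <= enorm u ^+ 2 * enorm x * c.
    rewrite -(@ler_pXn2r _ 2) ?nnegrE ?mulr_ge0 ?enorm_ge0 ?sqr_ge0//.
    rewrite (enorm_sqr x') /x' dot_orthogonal_part !xx -expr2 2!exprMn e2.
    have : (s * (enorm u * enorm x)) ^+ 2 <= dot u x ^+ 2.
      rewrite -[leRHS]sqrrN ler_pXn2r ?nnegrE ?mulr_ge0// ?(ltW U0)//.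
        by rewrite lerNr.
      by rewrite oppr_ge0 (le_trans ux)// oppr_le0 !mulr_ge0// ltW.
    move=> h1; have hh := mulr_ge0 (exprn_ge0 2 (ltW U0)) (etrans (subr_ge0 _ _) h1).
    rewrite -subr_ge0.
    by apply: le_trans hh _; rewrite le_eqVlt; apply/orP; left; apply/eqP; ring.
  have nz : enorm z' <= enorm u ^+ 2 * enorm z * s.
    rewrite -(@ler_pXn2r _ 2) ?nnegrE ?mulr_ge0 ?enorm_ge0 ?sqr_ge0//.
    rewrite (enorm_sqr z') /z' dot_orthogonal_part !xx -expr2 2!exprMn.
    have : (enorm u * enorm z * c) ^+ 2 <= dot u z ^+ 2.
      rewrite ler_pXn2r ?nnegrE ?mulr_ge0// ?(ltW U0)//.
      by rewrite (le_trans _ uz)// !mulr_ge0// ltW.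
    rewrite exprMn e2 => h1.
    have hh := mulr_ge0 (exprn_ge0 2 (ltW U0)) (etrans (subr_ge0 _ _) h1).
    rewrite -subr_ge0.
    by apply: le_trans hh _; rewrite le_eqVlt; apply/orP; left; apply/eqP; ring.
  (* Both the orthogonal product and the axial one are compared with [s * c] times the norms; adding
     the two bounds leaves [enorm u ^+ 4 * dot x z <= 0]. *)
  have := le_trans (dot_le_enorm x' z') (ler_pM (enorm_ge0 _) (enorm_ge0 _) nx nz).
  rewrite /x' /z' dot_orthogonal_part UE => h.
  have : (s * (enorm u * enorm x)) * (enorm u * enorm z * c) <= - dot u x * dot u z.
    by rewrite ler_pM ?mulr_ge0// ?(ltW U0)// lerNr.
  move=> h1; have h2 := mulr_ge0 (exprn_ge0 2 (ltW U0)) (etrans (subr_ge0 _ _) h1).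
  rewrite -subr_ge0 in h.
  rewrite -(pmulr_rle0 _ (exprn_gt0 4 U0)) -oppr_ge0.
  apply: le_trans (addr_ge0 h h2) _.
  by rewrite le_eqVlt; apply/orP; left; apply/eqP; ring.
Qed.
End cones.

(** * Reflections carrying one axis to another *)

Section reflections.
Context {R : realType} {n : nat}.
Implicit Types u x y w : 'rV[R]_n.

Definition reflection w : 'M[R]_n := 1%:M - (2 / dot w w) *: (w^T *m w).

Lemma mul_reflection w x : x *m reflection w = x - (2 * dot x w / dot w w) *: w.
Proof.
rewrite /reflection mulmxBr mulmx1 -scalemxAr mulmxA.
rewrite (_ : x *m w^T = (dot x w)%:M); last first.
  by apply/rowP => i; rewrite !ord1 !mxE mulr1n; apply: eq_bigr => j _; rewrite mxE.
by rewrite mul_scalar_mx scalerA mulrAC.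
Qed.

Lemma dot_reflection w x y : w != 0 ->
  dot (x *m reflection w) (y *m reflection w) = dot x y.
Proof.
rewrite -dot_eq0 => w0; rewrite !mul_reflection !dotE (dotC w y).
by field.
Qed.

Lemma reflectionK w : w != 0 -> reflection w *m reflection w = 1%:M.
Proof.
rewrite -dot_eq0 => w0; apply/row_matrixP => i; rewrite !rowE mulmxA mulmx1.
rewrite 2!mul_reflection -addrA -opprD -scalerDl !dotE.
by rewrite (_ : 2 * _ / _ + _ = 0) ?scale0r ?subr0//; field.
Qed.

End reflections.

(** The reflection in the hyperplane orthogonal to [u - u'] swaps two vectors of equal norm. Being
    an involution, it has determinant of absolute value 1. *)
Lemma orthogonal_transport {R : realType} n (u u' : 'rV[R]_n) :
  enorm u = enorm u' ->
  exists g : 'M[R]_n, [/\ g *m g = 1%:M,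
    forall x y, dot (x *m g) (y *m g) = dot x y & u *m g = u'].
Proof.
move=> uu'; have [<-|w0] := eqVneq u u'.
  by exists 1%:M; split; rewrite ?mulmx1// => x y; rewrite !mulmx1.
rewrite -subr_eq0 in w0.
exists (reflection (u - u')); split; first exact: reflectionK.
  by move=> x y; exact: dot_reflection.
have {}uu' : dot u u = dot u' u' by rewrite -!enorm_sqr uu'.
rewrite mul_reflection (_ : _ / _ = 1) ?scale1r ?subKr//.
move: w0; rewrite -dot_eq0 !dotE (dotC u' u) -uu' => w0.
by field.
Qed.

Lemma measurable_le d (T : measurableType d) {R : realType} (f g : T -> R) :
  measurable_fun setT f -> measurable_fun setT g ->
  measurable [set x | f x <= g x].
Proof.
move=> mf mg; rewrite -[X in measurable X]setTI.
rewrite (_ : [set x | f x <= g x] = (fun x => f x <= g x) @^-1` [set true]).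
  exact: measurable_fun_ler.
by apply/seteqP; split => x.
Qed.

Lemma measurable_lt d (T : measurableType d) {R : realType} (f g : T -> R) :
  measurable_fun setT f -> measurable_fun setT g ->
  measurable [set x | f x < g x].
Proof.
move=> mf mg; rewrite (_ : [set x | _] = ~` [set x | g x <= f x]).
  by apply: measurableC; exact: measurable_le.
by apply/seteqP; split => x /=; rewrite ltNge => /negP.
Qed.

(** * Solid caps: volume, invariance and null overlaps *)

Section solid_cap.
Context {R : realType} {n : nat}.
Implicit Types u x y w : 'rV[R]_n.

(* The origin is excluded, as in the union of the radii used by [surface_measure]. *)
Definition solid_ball : set (borelRn R n) := [set y | 0 < enorm y <= 1].

(** For [s] the sine of the half-angle, the union of the radii ending in the polar cap, in the form
    given by [polar_coneP]. *)
Definition solid_cap u (s : R) : set (borelRn R n) :=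
  [set y | 0 < enorm y <= 1 /\ s * (enorm u * enorm y) + dot u y <= 0].

Lemma measurable_dot u : measurable_fun setT (dot u : borelRn R n -> R).
Proof.
apply: measurable_sum => i; apply: measurable_funM => //; exact: measurable_coord.
Qed.

Lemma measurable_enorm : measurable_fun setT (enorm : borelRn R n -> R).
Proof.
apply: (@measurableT_comp _ _ _ _ _ _ (@Num.sqrt R) _ (fun x : borelRn R n => dot x x)).
  by apply: continuous_measurable_fun; exact: sqrt_continuous.
by apply: measurable_sum => i; apply: measurable_funM; exact: measurable_coord.
Qed.

Lemma measurable_solid_ball : measurable solid_ball.
Proof.
rewrite (_ : solid_ball = [set y | 0 < enorm y] `&` [set y | enorm y <= 1]).
  by apply: measurableI; [apply: measurable_lt|apply: measurable_le] => //;
    exact: measurable_enorm.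
by apply/seteqP; split => y /= /andP.
Qed.

Lemma measurable_solid_cap u s : measurable (solid_cap u s).
Proof.
apply: measurableI; first exact: measurable_solid_ball.
apply: measurable_le => //; apply: measurable_funD; last exact: measurable_dot.
by do 2 apply: measurable_funM => //; exact: measurable_enorm.
Qed.

Lemma leb_orthogonal (g : 'M[R]_n) (E : set (borelRn R n)) :
  g *m g = 1%:M -> measurable E -> leb R n ((fun v => v *m g) @^-1` E) = leb R n E.
Proof.
move=> gg mE; have [gu _] := mulmx1_unit gg.
have dg : `|\det g| = 1.
  apply/eqP; rewrite -(@eqrXn2 _ 2)// -normrX expr2 -det_mulmx gg det1 normr1.
  by rewrite expr1n.
by rewrite -[RHS](scales_volume_mulmxr gu).2// dg mul1e.
Qed.

(** Rescaling an axis does not change its cap, so the axes may be given equal norms and exchanged by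
    a reflection. *)
Lemma leb_solid_cap_axis u u' s : u != 0 -> u' != 0 ->
  leb R n (solid_cap u s) = leb R n (solid_cap u' s).
Proof.
move=> u0 u'0; pose k := enorm u / enorm u'.
have k0 : 0 < k by rewrite divr_gt0 ?enorm_gt0.
have -> : solid_cap u' s = solid_cap (k *: u') s.
  apply/seteqP; split => y [y1 h]; split => //; move: h;
    by rewrite enormZ gtr0_norm// dotZl -mulrA [s * (k * _)]mulrCA -mulrDr pmulr_rle0.
have [g [gg gdot <-]] : exists g : 'M[R]_n, [/\ g *m g = 1%:M,
    forall x y, dot (x *m g) (y *m g) = dot x y & u *m g = k *: u'].
  apply: orthogonal_transport; rewrite enormZ gtr0_norm// divfK//.
  by rewrite enorm_eq0.
have gE x : enorm (x *m g) = enorm x by rewrite /enorm gdot.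
rewrite -[RHS](leb_orthogonal gg); last exact: measurable_solid_cap.
congr leb; apply/seteqP; split => y; rewrite /solid_cap/= !gE gdot//.
Qed.

End solid_cap.

Section caps.
Context {R : realType}.

Lemma measurable_hyperplane n (w : 'rV[R]_n) :
  measurable ([set y | dot w y = 0] : set (borelRn R n)).
Proof.
exact: measurable_preimage (measurable_dot w)
  (measurable_set1 (0 : measurableTypeR R)).
Qed.

(** A reflection takes the normal to a multiple of the first basis vector, and the hyperplane to the
    product of [[set 0]] with the remaining coordinates. *)
Lemma leb_hyperplane n (w : 'rV[R]_n.+1) : w != 0 ->
  leb R n.+1 [set y | dot w y = 0] = 0%E.
Proof.
move=> w0.
pose e : 'rV[R]_n.+1 := delta_mx 0 0.
have dote y : dot e y = y 0 0.
  rewrite /dot (bigD1 0)//= mxE !eqxx mul1r big1 ?addr0// => i i0.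
  by rewrite mxE (negbTE i0) andbF mul0r.
have [g [gg gdot wg]] : exists g : 'M[R]_n.+1, [/\ g *m g = 1%:M,
    forall x y, dot (x *m g) (y *m g) = dot x y & w *m g = enorm w *: e].
  apply: orthogonal_transport; rewrite enormZ ger0_norm ?enorm_ge0//.
  by rewrite (_ : enorm e = 1) ?mulr1// /enorm dote mxE !eqxx sqrtr1.
have -> : [set y | dot w y = 0] =
    (fun v : 'rV[R]_n.+1 => v *m g) @^-1` [set y | dot e y = 0].
  apply/seteqP; split => y /=; rewrite -(gdot w y) wg dotZl.
    by move/eqP; rewrite mulf_eq0 enorm_eq0 (negbTE w0) => /eqP.
  by move=> ->; rewrite mulr0.
rewrite leb_orthogonal//; last exact: measurable_hyperplane.
rewrite lebS.
rewrite (_ : _ @^-1` _ = [set 0] `*` setT); last first.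
  by apply/seteqP; split => -[t v]/=; rewrite dote consv0//= => -[].
rewrite product_measure1E//.

by rewrite [X in (X * _)%E](_ : _ = 0%E) ?mul0e//; exact: lebesgue_measure_set1.
Qed.

Lemma solid_ball_box n : @solid_ball R n `<=` box 0 2.
Proof.
move=> y /andP[_ y1] i; rewrite mxE /ball/= sub0r normrN (le_lt_trans _ (ltr1n R 2))//.
apply: le_trans y1; rewrite -(@ler_pXn2r _ 2) ?nnegrE ?enorm_ge0//.
rewrite enorm_sqr real_normK ?num_real// /dot (bigD1 i)//= -expr2 lerDl.
by apply: sumr_ge0 => j _; rewrite -expr2 sqr_ge0.
Qed.

Lemma leb_solid_ball n : (leb R n (@solid_ball R n) < +oo)%E.
Proof.
apply: (@le_lt_trans _ _ (leb R n (box 0 2))); last by rewrite leb_box// ltry.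
apply: le_measure; rewrite ?inE; [exact: measurable_solid_ball|exact: measurable_box|].
exact: solid_ball_box.
Qed.

(** The point [p] of norm 1/2 opposite to [u] satisfies the defining inequalities strictly because
    [s < 1], so a small box around it fits in the cap. *)
Lemma leb_solid_cap_gt0 n (u : 'rV[R]_n.+1) s : u != 0 -> s < 1 ->
  (0 < leb R n.+1 (solid_cap u s))%E.
Proof.
move=> u0 s1; have U0 : 0 < enorm u by rewrite enorm_gt0.
pose p : 'rV[R]_n.+1 := - (2 * enorm u)^-1 *: u.
have cdot x : continuous (dot x : 'rV[R]_n.+1 -> R).
  by apply: continuous_dot => i; [exact: cst_continuous|exact: coord_continuous].
have cnorm : continuous (enorm : 'rV[R]_n.+1 -> R).
  move=> x; apply: (@continuous_comp _ _ _ (fun y : 'rV[R]_n.+1 => dot y y)).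
    by apply: continuous_dot => i; exact: coord_continuous.
  exact: sqrt_continuous.
have np : enorm p = 2^-1.
  rewrite enormZ normrN ger0_norm ?invr_ge0 ?mulr_ge0 ?(ltW U0)//.
  by field; rewrite gt_eqF.
have dp : dot u p = - (enorm u / 2).
  by rewrite /p dotZr -enorm_sqr; field; rewrite gt_eqF.
have : nbhs p [set y | enorm y < 1 /\ s * (enorm u * enorm y) + dot u y < 0].
  apply: filterI.
    apply: (cnorm p [set r | r < 1]); apply: open_nbhs_nbhs; split.
      exact: (@open_lt _ 1).
    by rewrite /= np invf_lt1// ltr1n.
  have cf : continuous (fun y : 'rV[R]_n.+1 => s * (enorm u * enorm y) + dot u y).
    have cM k (f : 'rV[R]_n.+1 -> R) : continuous f -> continuous (fun y => k * f y).
      by move=> cf x; apply: continuousM; [exact: cst_continuous|exact: cf].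
    by move=> x; exact: (cvgD (cM s _ (cM (enorm u) _ cnorm) x) (cdot u x)).
  apply: (cf p [set r | r < 0]); apply: open_nbhs_nbhs; split.
    exact: (@open_lt _ 0).
  by rewrite /= np dp subr_lt0 -[ltRHS]mul1r ltr_pM2r// divr_gt0.
move=> /nbhs_ballP[r /= r0 rp].
apply: (@lt_le_trans _ _ (leb R n.+1 (box p r))).
  by rewrite leb_box ?ltW// lte_fin exprn_gt0// mulr_gt0.
apply: le_measure; rewrite ?inE; [exact: measurable_box|exact: measurable_solid_cap|].
move=> y yp; have /rp[y1 y2] : ball p r y by split => // i j; rewrite !ord1; exact: yp.
split; last exact: ltW.
(* The strict inequality fails at the origin, so the box avoids it. *)
rewrite (ltW y1) andbT enorm_gt0; apply: contraTneq y2 => ->.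
by rewrite dotC dot0l enorm0 !mulr0 addr0 ltxx.
Qed.

Lemma radii_sphere d : [set (p.1 : R) *: p.2 | p in [set t : R | (0 < t <= 1)%R] `*`
  @sphere R d] = @solid_ball R d.+1.
Proof.
apply/seteqP; split => [_ [[t x] [/= t01 x1] <-]|y /= y01].
  rewrite /solid_ball/= enormZ x1 mulr1 ger0_norm//.
  by case/andP: t01 => /ltW.
have y0 : enorm y != 0 by case/andP: y01 => /lt0r_neq0.
exists (enorm y, (enorm y)^-1 *: y) => /=; last by rewrite scalerA divff// scale1r.
by split => //; rewrite /sphere/= enorm_normalize// -enorm_eq0.
Qed.

(** The cap condition is positively homogeneous: it holds at a point of a radius exactly when it
    holds at the end. *)
Lemma polar_cap_radii d (u : 'rV[R]_d.+1) eta : u != 0 -> 0 <= sin eta -> 0 <= cos eta ->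
  [set (p.1 : R) *: p.2 | p in [set t : R | (0 < t <= 1)%R] `*` polar_cap u eta] =
  solid_cap u (sin eta).
Proof.
move=> u0 s0 c0.
have capE x : (forall z, cone u eta z -> dot x z <= 0) <->
    sin eta * (enorm u * enorm x) + dot u x <= 0.
  have := polar_coneP x u0 s0 c0; rewrite addrC cos2Dsin2 => /(_ erefl) ->.
  by rewrite addrC -subr_le0 opprK.
apply/seteqP; split => [_ [[t x] [/= t01 [x1 /capE h]] <-]|y [y01 h]].
  split.
    by have : solid_ball (t *: x) by rewrite -radii_sphere; exists (t, x).
  have /andP[t0 _] := t01.
  rewrite enormZ gtr0_norm// dotZr [enorm u * _]mulrCA [sin eta * _]mulrCA.
  by rewrite -mulrDr pmulr_rle0.
have : solid_ball y by [].
rewrite -radii_sphere => -[[t x] [/= t01 x1] yE].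
exists (t, x) => //; split => //; split => //.
apply/capE; move: h; have /andP[t0 _] := t01.
rewrite -yE enormZ gtr0_norm// dotZr [enorm u * _]mulrCA [sin eta * _]mulrCA.
by rewrite -mulrDr pmulr_rle0.
Qed.

Lemma solid_cap_sub_ball n (u : 'rV[R]_n) s : solid_cap u s `<=` @solid_ball R n.
Proof. by move=> y []. Qed.

Lemma fin_num_leb_solid_ball n : leb R n (@solid_ball R n) \is a fin_num.
Proof. by rewrite ge0_fin_numE ?measure_ge0//; exact: leb_solid_ball. Qed.

Lemma fin_num_leb_solid_cap n (u : 'rV[R]_n) s : leb R n (solid_cap u s) \is a fin_num.
Proof.
rewrite ge0_fin_numE ?measure_ge0//; apply: le_lt_trans (leb_solid_ball n).
apply: le_measure; rewrite ?inE.
- exact: measurable_solid_cap.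
- exact: measurable_solid_ball.
- exact: solid_cap_sub_ball.
Qed.

Lemma cap_fractionE d (u : 'rV[R]_d.+1) eta : u != 0 -> 0 <= sin eta -> 0 <= cos eta ->
  cap_fraction u eta = fine (leb R d.+1 (solid_cap u (sin eta))) /
    fine (leb R d.+1 (@solid_ball R d.+1)).
Proof.
move=> u0 s0 c0; rewrite /cap_fraction /surface_measure radii_sphere polar_cap_radii//.
rewrite -!/(leb _ _ _) !fineM//.
- rewrite -mulf_div divff ?mul1r//= pnatr_eq0//.
- exact: fin_num_leb_solid_ball.
- exact: fin_num_leb_solid_cap.
Qed.

End caps.

(** * Packing of normal cones *)

(** Removing from each [K i] its null overlap [N i] with the others yields disjoint sets of
    unchanged measure. *)
Lemma sum_measure_ae_disjoint d (T : measurableType d) {R : realType}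
    (mu : {measure set T -> \bar R}) (I : choiceType) (B : {fset I})
    (K : I -> set T) (S : set T) :
  (forall i, i \in B -> measurable (K i)) -> measurable S ->
  (forall i, i \in B -> K i `<=` S) ->
  (forall i j, i \in B -> j \in B -> i != j -> mu (K i `&` K j) = 0%E) ->
  (\sum_(i <- B) mu (K i) <= mu S)%E.
Proof.
move=> mK mS KS K0.
pose N i := \big[setU/set0]_(j <- B | j != i) K j.
have mN i : measurable (N i).
  rewrite /N big_seq_cond; apply: bigsetU_measurable => j /andP[jB _]; exact: mK.
have KN i : i \in B -> mu (K i `&` N i) = 0%E.
  move=> iB; rewrite /N setIC big_distrl/= big_seq_cond.
  suff [] : measurable (\big[setU/set0]_(j <- B | (j \in B) && (j != i)) (K j `&` K i)) /\
      mu (\big[setU/set0]_(j <- B | (j \in B) && (j != i)) (K j `&` K i)) = 0%E by [].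
  elim/big_ind: _ => [|X Y [mX X0] [mY Y0]|j /andP[jB ji]].
  - by rewrite measure0.
  - by split; [exact: measurableU|exact: null_set_setU].
  - by split; [apply: measurableI; exact: mK|exact: K0].
have KE i : i \in B -> mu (K i) = mu (K i `\` N i).
  by move=> iB; rewrite (measureDI mu (mK i iB) (mN i)) [X in (_ + X)%E](KN i iB) adde0.
rewrite big_seq_cond (eq_bigr (fun i => mu (K i `\` N i))); last first.
  by move=> i /andP[iB _]; exact: KE.
rewrite -big_seq_cond -measure_fbigsetU.
- apply: le_measure; rewrite ?inE//.
    rewrite big_seq_cond; apply: bigsetU_measurable => i /andP[iB _].
    by apply: measurableD => //; exact: mK.
  rewrite -bigcup_fset; apply: bigcup_sub => i iB.
  exact: subset_trans (@subDsetl _ _ _) (KS i iB).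
- by move=> i iB; apply: measurableD => //; exact: mK.
- apply/trivIsetP => i j iB jB ij; apply/seteqP; split => // x [[Ki _] [_]]; apply.
  rewrite /N -bigcup_seq_cond; exists i => //=; exact/andP.
Qed.

(** * The angle bound and the half-angle [eta_d] *)

Section angles.
Context {R : realType}.

Lemma ler_cos : {in `[0, pi] &, {mono (@cos R) : x y /~ y <= x}}.
Proof. by move=> x y x0pi y0pi; rewrite !leNgt ltr_cos. Qed.

(** The angle [acos D] of a triple is a lower bound of the nonempty set of admissible bounds, hence
    at most their infimum, hence at most [t]. *)
Lemma angle_le_no_angle_above n (A : set 'rV[R]_n) t : angle A <= t -> 0 <= t <= pi ->
  no_angle_above A t.
Proof.
move=> At t0pi x y z Ax Ay Az xy zy.
have D1 (x' y' z' : 'rV[R]_n) : x' != y' -> z' != y' ->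
    -1 <= dot ((enorm (x' - y'))^-1 *: (x' - y'))
              ((enorm (z' - y'))^-1 *: (z' - y')) <= 1.
  move=> x'y' z'y'; rewrite -ler_norml (le_trans (cauchy_schwarz _ _))//.
  by rewrite !enorm_normalize ?subr_eq0// mulr1.
have := D1 _ _ _ xy zy; set D := dot _ _ => D11.
rewrite -[leRHS]acosK ?in_itv//= ler_cos ?in_itv/= ?acos_ge0 ?acos_lepi//.
apply: le_trans At; apply: lb_le_inf.
  exists pi; split; first by rewrite pi_ge0 lexx.
  by move=> x' y' z' _ _ _ x'y' z'y'; rewrite cospi; have /andP[] := D1 _ _ _ x'y' z'y'.
move=> s [s0pi /(_ x y z Ax Ay Az xy zy)]; rewrite -/D => sD.
by rewrite -ler_cos ?in_itv/= ?acos_ge0 ?acos_lepi// acosK// in_itv.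
Qed.

Lemma sin_half_sqr (x : R) : sin (x / 2) ^+ 2 = (1 - cos x) / 2.
Proof.
rewrite {2}(_ : x = (x / 2) *+ 2); last by rewrite -mulr_natr divfK.
by rewrite cos_mulr2n cos2sin2 mulr2n; field.
Qed.

Lemma cos_theta k : cos (@theta R k.+1) = - k.+1%:R^-1.
Proof.
by rewrite /theta div1r acosK// in_itv/= lerN2 invf_le1 ?ler1n ?ltr0n//=.
Qed.

Lemma theta_gt0_lepi k : 0 < @theta R k.+1 <= pi.
Proof.
have h : -1 <= - (1 / k.+1%:R : R) < 1.
  by rewrite div1r lerN2 invf_le1 ?ler1n ?ltr0n//=.
have /andP[h1 h2] := h.
by rewrite /theta acos_gt0// acos_lepi// h1 ltW.
Qed.

Section eta.
Context (d : nat) (t : R) (ht : 0 < t < theta d.+2).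

Lemma angle_gt0_ltpi : 0 < t < pi.
Proof.
case/andP: ht => -> /lt_le_trans; apply; by have /andP[] := theta_gt0_lepi d.+1.
Qed.

(** Cosine decreases on [[0, pi]] and equals [- 1 / (d + 2)] at [theta d.+2]. The dimension of the
    theorem is written [d.+1] here. *)
Lemma cos_gt_simplex : 0 < 1 + d.+2%:R * cos t.
Proof.
have /andP[t0 tpi] := angle_gt0_ltpi; have /andP[_ tt] := ht.
have /andP[T0 Tpi] := theta_gt0_lepi d.+1.
have : cos (@theta R d.+2) < cos t.
  by rewrite ltr_cos ?in_itv/= ?(ltW t0) ?(ltW tpi) ?(ltW T0).
rewrite cos_theta -(ltr_pM2l (ltr0Sn R d.+1)) mulrN divff ?pnatr_eq0//.
by rewrite -subr_gt0 opprK addrC.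
Qed.

Lemma cos_gt_simplex_pred : 0 < 1 + d.+1%:R * cos t.
Proof.
have h := cos_gt_simplex; have [c0|c0] := leP 0 (cos t).
  by rewrite ltr_wpDr// mulr_ge0.
apply: lt_trans h _; rewrite ltrD2l ltr_nM2r// ltr_nat//.
Qed.

Let q := sin (t / 2) / sin (@theta R d.+1 / 2).

(** Half-angle formulas turn the quotient of sines into Jung's constant: [1 - q ^+ 2] is the lower
    bound for [dot p p] in [spherical_jung]. *)
Lemma sin_eta_sqr : q ^+ 2 = 1 - (1 + d.+1%:R * cos t) / d.+2%:R.
Proof.
rewrite /q exprMn exprVn !sin_half_sqr cos_theta opprK.
have h1 : d.+1%:R != 0 :> R by rewrite pnatr_eq0.
have h2 : d.+1%:R + 1 != 0 :> R by rewrite natr1 pnatr_eq0.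
rewrite -(natr1 d.+1); move: (d.+1%:R : R) h1 h2 => a h1 h2; field.
by rewrite h1 h2.
Qed.

Lemma sin_eta_gt0_lt1 : 0 < q < 1.
Proof.
have /andP[t0 tpi] := angle_gt0_ltpi; have /andP[T0 Tpi] := theta_gt0_lepi d.
have half (x : R) : 0 < x -> x <= pi -> 0 < sin (x / 2).
  move=> x0 xpi; apply: sin_gt0_pi; rewrite divr_gt0//=.
  by rewrite ltr_pdivrMr// (le_lt_trans xpi)// ltr_pMr ?pi_gt0// ltr1n.
have q0 : 0 < q by rewrite divr_gt0// half// ltW.
rewrite q0 -(@expr_lt1 _ 2) ?(ltW q0)//= sin_eta_sqr ltrBlDr ltrDl.
by rewrite divr_gt0// cos_gt_simplex_pred.
Qed.

Let qI : -1 <= q <= 1.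
Proof.
have /andP[q0 q1] := sin_eta_gt0_lt1.
by rewrite (ltW q1) (le_trans _ (ltW q0))// oppr_le0.
Qed.

Lemma sin_eta : sin (eta_d d.+1 t) = q.
Proof. by rewrite /eta_d asinK// in_itv. Qed.

Lemma cos_eta : cos (eta_d d.+1 t) = Num.sqrt ((1 + d.+1%:R * cos t) / d.+2%:R).
Proof. by rewrite /eta_d cos_asin// -/q sin_eta_sqr opprB addrCA subrr addr0. Qed.

Lemma eta_bounds : 0 < eta_d d.+1 t < pi / 2.
Proof.
have /andP[q0 q1] := sin_eta_gt0_lt1; have /andP[qN _] := qI.
rewrite [X in _ && X]asin_ltpi2 ?qN// andbT ltNge; apply/negP => eta0.
(* If [eta_d] were at most 0, its opposite would lie in [[0, pi]], where sine is nonnegative,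
   against [sin_eta] and [0 < q]. *)
have : 0 <= sin (- eta_d d.+1 t).
  apply: sin_ge0_pi; rewrite oppr_ge0 eta0/= lerNl.
  rewrite (le_trans _ (asin_geNpi2 qI))// lerN2 ler_pdivrMr// ler_peMr ?pi_ge0// ler1n//.
by rewrite sinN sin_eta oppr_ge0 leNgt q0.
Qed.

End eta.
End angles.

Section packing.
Context {R : realType} (d : nat) (t : R) (A : set 'rV[R]_d.+2)
  (ht : 0 < t < theta d.+2) (At : no_angle_above A t).
Let eta := eta_d d.+1 t.

Lemma cone_axis (B : {fset 'rV[R]_d.+2}) y : [set` B] `<=` A -> y \in B ->
  exists2 u : 'rV[R]_d.+2, u != 0 & forall x, x \in B -> cone u eta (x - y).
Proof.
move=> BA yB; pose s := [seq x <- B | x != y].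
have [s0|[m ms]] : s = [::] \/ exists m, size s = m.+1.
  by case: (s) => [|a l]; [left|right; exists (size l)].
  (* Without other points any nonzero axis serves, since the zero vector is in every cone. *)
  exists (delta_mx 0 0) => [|x xB].
    by apply/eqP => /matrixP/(_ 0 0)/eqP; rewrite !mxE !eqxx oner_eq0.
  have [->|xy] := eqVneq x y.
    by rewrite subrr /cone/= dotC dot0l enorm0 mulr0 mul0r.
  have : x \in s by rewrite mem_filter xy.
  by rewrite s0.
pose V : 'M[R]_(m.+1, d.+2) :=
  \matrix_(i < m.+1) ((enorm (nth 0 s i - y))^-1 *: (nth 0 s i - y)).
have sP (i : 'I_m.+1) : A (nth 0 s i) /\ nth 0 s i != y.
  have : nth 0 s i \in s by rewrite mem_nth// ms.
  by rewrite mem_filter => /andP[? /BA].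
have V1 i : dot (row i V) (row i V) = 1.
  by rewrite rowK -enorm_sqr enorm_normalize ?expr1n// subr_eq0; case: (sP i).
have Vc i j : cos t <= dot (row i V) (row j V).
  by rewrite !rowK; have [[? ?] [? ?]] := (sP i, sP j); apply: At => //; exact: BA.
have [p [pp pV]] := spherical_jung (cos_le1 t) (cos_gt_simplex ht) V1 Vc.
(* The axis is [p]: [dot p v >= enorm p ^+ 2 >= enorm p * cos eta] for each unit direction [v]. *)
have pc : cos eta <= enorm p by rewrite /eta (cos_eta ht) ler_wsqrtr.
have c0 : 0 < cos eta.
  by rewrite /eta (cos_eta ht) sqrtr_gt0 divr_gt0// cos_gt_simplex_pred.
have p0 : 0 < enorm p by exact: lt_le_trans pc.
exists p => [|x xB]; first by rewrite -enorm_gt0.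
have [->|xy] := eqVneq x y.
  by rewrite subrr /cone/= dotC dot0l enorm0 mulr0 mul0r.
have xs : x \in s by rewrite mem_filter xy.
have im : (index x s < m.+1)%N by rewrite -ms index_mem.
have := pV (Ordinal im); rewrite rowK/= nth_index// dotZr -enorm_sqr.
have n0 : 0 < enorm (x - y) by rewrite enorm_gt0 subr_eq0.
rewrite mulrC ler_pdivlMr// => h; rewrite /cone/=; apply: le_trans h.
by rewrite expr2 mulrAC ler_pM2r// ler_pM2l.
Qed.
Lemma card_le_cap (B : {fset 'rV[R]_d.+2}) (u : 'rV[R]_d.+2) :
  [set` B] `<=` A -> u != 0 ->
  (#|` B|%:R * fine (leb R d.+2 (solid_cap u (sin eta))) <=
   fine (leb R d.+2 (@solid_ball R d.+2))).
Proof.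
move=> BA u0.
have ax y : y \in B -> exists u : 'rV[R]_d.+2,
    u != 0 /\ forall x, x \in B -> cone u eta (x - y).
  by move=> /(cone_axis BA)[v v0 vc]; exists v.
have /choice[axis axisP] : forall y, exists u : 'rV[R]_d.+2,
    y \in B -> u != 0 /\ forall x, x \in B -> cone u eta (x - y).
  move=> y; have [/ax[v vP]|yB] := boolP (y \in B); first by exists v.
  by exists 0.
have /andP[q0 q1] := sin_eta_gt0_lt1 ht.
rewrite -(sin_eta ht) -/eta in q0 q1.
have c0 : 0 <= cos eta by rewrite (cos_eta ht) sqrtr_ge0.
have sc : sin eta ^+ 2 + cos eta ^+ 2 = 1 by rewrite addrC cos2Dsin2.
have ballfin := fin_num_leb_solid_ball (R := R) d.+2.
have capfin := fin_num_leb_solid_cap u (sin eta).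
rewrite -lee_fin EFinM !fineK//.
(* All caps have the volume of the one about [u], whatever their axes. *)
have -> : (#|` B|%:R%:E * leb R d.+2 (solid_cap u (sin eta)) =
    \sum_(y <- B) leb R d.+2 (solid_cap (axis y) (sin eta)))%E.
  rewrite big_seq (eq_bigr (fun=> leb R d.+2 (solid_cap u (sin eta)))); last first.
    by move=> y /axisP[v0 _]; exact: leb_solid_cap_axis.
  rewrite -big_seq -(fineK capfin) sumEFin big_const_seq count_predT iter_addr.
  by rewrite addr0 -EFinM mulr_natl.
apply: sum_measure_ae_disjoint => [y yB||y yB|x y xB yB xy].
- exact: measurable_solid_cap.
- exact: measurable_solid_ball.
- exact: solid_cap_sub_ball.
have yx0 : y - x != 0 by rewrite subr_eq0 eq_sym.
apply: (@subset_measure0 _ _ _ (leb R d.+2) _ [set w | dot (y - x) w = 0]).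
- by apply: measurableI; exact: measurable_solid_cap.
- exact: measurable_hyperplane.
- move=> w [[w1 wx] [_ wy]] /=.
  have [ax0 axc] := axisP _ xB; have [ay0 ayc] := axisP _ yB.
  have h v p : v != 0 -> sin eta * (enorm v * enorm w) + dot v w <= 0 ->
      cone v eta p -> dot w p <= 0.
    move=> v0 vw vp; have [_] := polar_coneP w v0 (ltW q0) c0 sc; apply => //.
    by rewrite -subr_le0 opprK addrC.
  (* [y - x] lies in the cone at [x] and [x - y] in the cone at [y], which bounds the same product
     from both sides. *)
  have h1 := h _ _ ax0 wx (axc _ yB); have h2 := h _ _ ay0 wy (ayc _ xB).
  apply/eqP; rewrite eq_le dotC h1/= -oppr_le0 -dotNr opprB//.
- exact: leb_hyperplane.
Qed.
End packing.

Theorem theorem1p3 (R : realType) (d : nat) (hd : (1 <= d)%N)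
    (t : R) (ht : 0 < t < theta d.+1) (A : set 'rV[R]_d.+1)
    (hA : angle A <= t) (u : 'rV[R]_d.+1) (hu : u != 0) :
  0 < eta_d d t < pi / 2 /\
  finite_set A /\
  (#|` fset_set A|)%:R <= 1 / cap_fraction u (eta_d d t).
Proof.
case: d hd ht A hA u hu => // d _ ht A hA u hu.
have /andP[t0 tpi] := angle_gt0_ltpi ht.
have At : no_angle_above A t.
  by apply: angle_le_no_angle_above => //; rewrite !ltW.
have /andP[q0 q1] := sin_eta_gt0_lt1 ht.
have c0 : 0 <= cos (eta_d d.+1 t) by rewrite (cos_eta ht) sqrtr_ge0.
have s0 : 0 <= sin (eta_d d.+1 t) by rewrite (sin_eta ht) ltW.
have s1 : sin (eta_d d.+1 t) < 1 by rewrite (sin_eta ht).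
set K := fine (leb R d.+2 (solid_cap u (sin (eta_d d.+1 t)))).
set M := fine (leb R d.+2 (@solid_ball R d.+2)).
have K0 : 0 < K.
  apply: fine_gt0; rewrite leb_solid_cap_gt0// -ge0_fin_numE ?measure_ge0//.
  exact: fin_num_leb_solid_cap.
(* The bound is uniform over finite subsets, so it also yields finiteness of [A]. *)
have bound B : [set` B] `<=` A -> #|` B|%:R <= M / K.
  by move=> BA; rewrite ler_pdivlMr//; exact: (card_le_cap ht At).
have finA : finite_set A.
  (* An infinite [A] would contain a finite subset with more than [M / K] points. *)
  apply: contrapT => /(infinite_set_fset (Num.truncn (M / K)).+1)[B /bound BMK].
  rewrite -(ler_nat R) => /le_trans/(_ BMK); apply/negP; rewrite -ltNge.
  exact: truncnS_gt.
split; first exact: eta_bounds.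
split => //; rewrite cap_fractionE// -/K -/M div1r invf_div.
apply: bound; rewrite fset_setK//.
Qed.
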